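(* Let $M$ be an Anosov bundle or an Anosov double. Then $\pi_1(M)$ has Property A.
   Context: An automorphism of a group $G$ is class preserving if it maps every conjugacy class of $G$ to itself. A group $G$ has (Grossman's) Property A if every class preserving automorphism of $G$ is inner. All manifolds are connected and orientable. An Anosov bundle is a closed orientable $3$-manifold that is a torus bundle over the circle whose monodromy is Anosov, i.e. acts on $\pi_1$ of the torus fiber by a matrix $A\in\mathrm{SL}_2(\mathbb{Z})$ with $|\mathrm{tr}(A)|>2$. An Anosov double is a closed orientable $3$-manifold formed by gluing two (orientable) twisted $I$-bundles over the Klein bottle together by a diffeomorphism of their torus boundaries, and having a nontrivial double cover which is an Anosov bundle. (Equivalently, $M$ is a closed $3$-manifold supporting Sol-geometry.) *)

(* Defs.v *)
From HB Require Import structures.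
From Stdlib Require Import Relations.
From mathcomp Require Import all_boot all_order all_algebra.
From mathcomp Require Import generic_quotient.
From mathcomp Require Import all_classical all_reals.
From mathcomp Require Import topology normedtype continuous_path.
From mathcomp Require Import lra.

Set Implicit Arguments.
Unset Strict Implicit.
Unset Printing Implicit Defensive.

Import Order.TTheory GRing.Theory Num.Theory.
Import numFieldNormedType.Exports.

Local Open Scope classical_set_scope.
Local Open Scope ring_scope.
Local Open Scope quotient_scope.

(** * Property A *)

Section PropertyA.
Variable G : groupType.

Definition conj_class (g : G) : set G := [set (g ^ h)%g | h in [set: G]].

Definition class_preserving (phi : G -> G) :=
  forall g, phi @` conj_class g = conj_class g.

Definition inner (phi : G -> G) := exists h, forall g, phi g = (g ^ h)%g.

Definition property_A := forall phi : {multiplicative G -> G},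
  bijective phi -> class_preserving phi -> inner phi.

End PropertyA.

(** * Quotients, homeomorphisms, two-sheeted coverings *)

Section Quotient.
Variables (T : topologicalType) (r : T -> T -> Prop).

Let gen (x y : T) : bool := `[< clos_refl_sym_trans T r x y >].

Local Lemma gen_refl : reflexive gen.
Proof. by move=> x; apply/asboolP/rst_refl. Qed.

Local Lemma gen_sym : symmetric gen.
Proof. by move=> x y; apply/asboolP/asboolP; exact: rst_sym. Qed.

Local Lemma gen_trans : transitive gen.
Proof.
by move=> y x z /asboolP xy /asboolP yz; apply/asboolP/(rst_trans _ _ _ y).
Qed.

Definition generated_equiv := EquivRel gen gen_refl gen_sym gen_trans.

(* [T] modulo the equivalence relation generated by [r], with the quotient
   topology. *)
Definition quot := {eq_quot generated_equiv}.

HB.instance Definition _ := Topological.copy quot (quotient_topology quot).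
HB.instance Definition _ := Quotient.on quot.

Definition quot_pi (x : T) : quot := \pi_quot x.

Lemma quot_pi_continuous : continuous quot_pi.
Proof. exact: pi_continuous. Qed.

Lemma quot_piP x y :
  quot_pi x = quot_pi y <-> clos_refl_sym_trans T r x y.
Proof. by split=> [/eqmodP/asboolP //|xy]; apply/eqmodP/asboolP. Qed.

End Quotient.

Definition homeomorphism (X Y : topologicalType) (f : X -> Y) :=
  continuous f /\ exists g : Y -> X, [/\ continuous g, cancel f g & cancel g f].

Definition homeomorphic (X Y : topologicalType) :=
  exists f : X -> Y, homeomorphism f.

(* [p] restricts to a homeomorphism from [V] onto [U]. *)
Definition homeomorphism_on (X Y : topologicalType) (V : set X) (U : set Y)
    (p : X -> Y) :=
  {within V, continuous p} /\
  exists s : Y -> X, {within U, continuous s} /\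
    [/\ p @` V = U, s @` U = V, {in V, cancel p s} & {in U, cancel s p}].

(* The two sheets over an evenly covered open set are indexed by [bool]. *)
Definition double_covering (E B : topologicalType) (p : E -> B) :=
  continuous p /\
  forall b, exists (U : set B) (V : bool -> set E),
    [/\ open U /\ U b, forall k, open (V k), V true `&` V false = set0,
        p @^-1` U = V true `|` V false
      & forall k, homeomorphism_on (V k) U p].

Definition trivial_double_covering (E B : topologicalType) (p : E -> B) :=
  exists h : E -> (B * bool)%type, homeomorphism h /\ forall e, (h e).1 = p e.

(** * The fundamental group *)

Section UnitInterval.
Variable R : realType.

Definition unit_interval : Type := `[0 : R, 1]%classic.

HB.instance Definition _ :=
  Topological.copy unit_interval (set_type `[0 : R, 1]%classic).

Definition uival (t : unit_interval) : R := \val t.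

Lemma uival_continuous : continuous uival.
Proof. exact: initial_continuous. Qed.

Lemma uival_itv t : 0 <= uival t <= 1.
Proof. by have := set_mem (valP t); rewrite /= in_itv. Qed.

Local Lemma clip_subproof (t : R) :
  Num.max 0 (Num.min 1 t) \in `[0 : R, 1]%classic.
Proof.
apply/mem_set; rewrite /= in_itv /= le_max lexx /=.
by rewrite ge_max ler01 ge_min lexx.
Qed.

(* Retraction of the line onto the unit interval. *)
Definition clip (t : R) : unit_interval :=
  exist (fun s => s \in `[0 : R, 1]%classic) _ (clip_subproof t).

Lemma uival_clip t : uival (clip t) = Num.max 0 (Num.min 1 t).
Proof. by []. Qed.

Lemma uival_clip_id t : 0 <= t <= 1 -> uival (clip t) = t.
Proof.
by move=> /andP[t0 t1]; rewrite uival_clip (min_idPr t1) (max_idPr t0).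
Qed.

Lemma uival_inj : injective uival.
Proof. by move=> s t st; apply: val_inj. Qed.

Lemma clipK t : clip (uival t) = t.
Proof. by apply: uival_inj; rewrite uival_clip_id ?uival_itv. Qed.

Lemma clip_continuous : continuous clip.
Proof.
apply: (@continuous_comp_initial _ _ _ set_val) => t.
rewrite -[_ \o _]/(fun t : R => Num.max 0 (Num.min 1 t)).
apply: continuous_max; first exact: cvg_cst.
by apply: continuous_min; [exact: cvg_cst|exact: cvg_id].
Qed.

Local Lemma clip01 : clip 0 != clip 1.
Proof.
apply/eqP => /(congr1 uival); rewrite !uival_clip_id ?lexx ?ler01 //.
by move/eqP; rewrite eq_sym oner_eq0.
Qed.

HB.instance Definition _ :=
  @isBiPointed.Build unit_interval (clip 0) (clip 1) clip01.

End UnitInterval.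

Lemma paste_continuous (R : realType) (X Y : topologicalType) (a : X -> R)
    (c : R) (f g : X -> Y) :
  continuous a -> continuous f -> continuous g ->
  (forall x, a x = c -> f x = g x) ->
  continuous (fun x => if a x <= c then f x else g x).
Proof.
move=> ca cf cg fg.
have cl1 : closed (a @^-1` [set r | r <= c]).
  by apply: preimage_closed (@closed_le _ c) => x _; exact: ca.
have cl2 : closed (a @^-1` [set r | c <= r]).
  by apply: preimage_closed (@closed_ge _ c) => x _; exact: ca.
apply/continuous_subspace_setT.
have -> : [set: X] =
    (a @^-1` [set r | r <= c]) `|` (a @^-1` [set r | c <= r]).
  by apply/seteqP; split=> // x _; have /orP := le_total (a x) c.
apply: withinU_continuous => //.
  apply: (@subspace_eq_continuous _ _ _ f); last exact: continuous_subspaceT.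
  move=> x /set_mem /= xc.
  by rewrite -[RHS]/(if a x <= c then f x else g x) xc.
apply: (@subspace_eq_continuous _ _ _ g); last exact: continuous_subspaceT.
move=> x /set_mem /= cx.
rewrite -[RHS]/(if a x <= c then f x else g x); case: ifPn => // xc.
by rewrite fg//; apply/eqP; rewrite eq_le xc cx.
Qed.

Lemma continuous_o (X Y Z : topologicalType) (f : X -> Y) (g : Y -> Z) :
  continuous f -> continuous g -> continuous (fun x => g (f x)).
Proof. by move=> cf cg x; apply: (continuous_comp (cf x)); exact: cg. Qed.

Lemma continuous_pair (X Y Z : topologicalType) (f : X -> Y) (g : X -> Z) :
  continuous f -> continuous g -> continuous (fun x => (f x, g x)).
Proof. by move=> cf cg x; apply: cvg_pair; [exact: cf|exact: cg]. Qed.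

Lemma continuous_fst' (X Y : topologicalType) :
  continuous (fun x : X * Y => x.1).
Proof. by move=> x; exact: cvg_fst. Qed.

Lemma continuous_snd' (X Y : topologicalType) :
  continuous (fun x : X * Y => x.2).
Proof. by move=> x; exact: cvg_snd. Qed.

Section Homotopy.
Context {R : realType} {T : topologicalType}.
Local Notation I := (unit_interval R).
Implicit Types x y z : T.

(* Homotopy relative to the endpoints. *)
Definition path_homotopic x y (p q : {path I from x to y in T}) :=
  exists H : (I * I)%type -> T,
    [/\ continuous H,
        forall t, H (zero, t) = p t, forall t, H (one, t) = q t
      & forall s, H (s, zero) = x /\ H (s, one) = y].

Lemma uival_zero : uival (zero : I) = 0.
Proof. by apply: uival_clip_id; rewrite lexx ler01. Qed.

Lemma uival_one : uival (one : I) = 1.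
Proof. by apply: uival_clip_id; rewrite lexx ler01. Qed.

Lemma clip0 (t : R) : t <= 0 -> clip t = zero.
Proof.
move=> t0; apply: uival_inj; rewrite uival_clip uival_zero; apply/max_idPl.
by rewrite ge_min t0 orbT.
Qed.

Lemma clip1 (t : R) : 1 <= t -> clip t = one.
Proof.
by move=> t0; apply: uival_inj; rewrite uival_clip uival_one (min_idPl t0)
  (max_idPr ler01).
Qed.

Local Lemma path_clip_continuous x y (p : {path I from x to y in T})
    (h : R -> R) : continuous h -> continuous (fun t : I => p (clip (h (uival t)))).
Proof.
move=> ch; apply: (continuous_o (f := fun t : I => clip (h (uival t))) (g := p)).
  apply: (continuous_o (f := fun t : I => h (uival t)) (g := @clip R)).
    exact: (continuous_o (@uival_continuous R) ch).
  exact: clip_continuous.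
exact: cts_fun.
Qed.

Section cat.
Variables (x y z : T).
Variables (p : {path I from x to y in T}) (q : {path I from y to z in T}).

Definition path_cat_fun (t : I) : T :=
  if uival t <= 2^-1 then p (clip (uival t * 2)) else q (clip (uival t * 2 - 1)).

Local Lemma path_cat_continuous : continuous path_cat_fun.
Proof.
apply: paste_continuous.
- exact: uival_continuous.
- apply: (path_clip_continuous (h := fun r => r * 2)) => r.
  exact: cvgM cvg_id (cvg_cst _).
- apply: (path_clip_continuous (h := fun r => r * 2 - 1)) => r.
  by apply: cvgB; [exact: cvgM cvg_id (cvg_cst _)|exact: cvg_cst].
- move=> t ->; rewrite mulVf ?pnatr_eq0// subrr.
  by rewrite (clip0 (lexx 0)) (clip1 (lexx 1)) path_zero path_one.
Qed.

Local Lemma path_cat_zero : path_cat_fun zero = x.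
Proof.
by rewrite /path_cat_fun uival_zero invr_ge0 ler0n mul0r clip0 ?path_zero.
Qed.

Local Lemma path_cat_one : path_cat_fun one = z.
Proof.
rewrite /path_cat_fun uival_one mul1r ifF; last first.
  by apply/negbTE; rewrite -ltNge invf_lt1 ?ltr0n// ltr1n.
by rewrite clip1 ?path_one//; lra.
Qed.

(* First [p], then [q]. *)
Definition path_cat : {path I from x to z in T} :=
  mk_path path_cat_continuous path_cat_zero path_cat_one.

End cat.

Section rev.
Variables (x y : T) (p : {path I from x to y in T}).

Definition path_rev_fun (t : I) : T := p (clip (1 - uival t)).

Local Lemma path_rev_continuous : continuous path_rev_fun.
Proof.
apply: (path_clip_continuous (h := fun r => 1 - r)) => r.
by apply: cvgB; [exact: cvg_cst|exact: cvg_id].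
Qed.

Local Lemma path_rev_zero : path_rev_fun zero = y.
Proof. by rewrite /path_rev_fun uival_zero subr0 clip1 ?path_one. Qed.

Local Lemma path_rev_one : path_rev_fun one = x.
Proof. by rewrite /path_rev_fun uival_one subrr clip0 ?path_zero. Qed.

Definition path_rev : {path I from y to x in T} :=
  mk_path path_rev_continuous path_rev_zero path_rev_one.

End rev.

Definition path_cst (x : T) : {path I from x to x in T} := cst x.

Lemma path_catE x y z (p : {path I from x to y in T})
    (q : {path I from y to z in T}) (u : R) : 0 <= u <= 1 ->
  path_cat p q (clip u) =
  if u <= 2^-1 then p (clip (u * 2)) else q (clip (u * 2 - 1)).
Proof. by move=> u01; rewrite /path_cat /= /mk_path /path_cat_fun uival_clip_id. Qed.

Lemma path_homotopic_refl x y (p : {path I from x to y in T}) :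
  path_homotopic p p.
Proof.
exists (fun u => p u.2); split=> //.
  apply: (continuous_o (g := p)); first exact: continuous_snd'.
  exact: cts_fun.
by move=> s; rewrite path_zero path_one.
Qed.

Lemma path_homotopic_sym x y (p q : {path I from x to y in T}) :
  path_homotopic p q -> path_homotopic q p.
Proof.
move=> [H [cH H0 H1 Hxy]]; exists (fun u => H (clip (1 - uival u.1), u.2)).
split=> [|t|t|s] /=.
- apply: (continuous_o (f := fun u : I * I => (clip (1 - uival u.1), u.2))) cH.
  apply: continuous_pair; last exact: continuous_snd'.
  apply: (continuous_o (f := fun u : I * I => 1 - uival u.1)); last first.
    exact: clip_continuous.
  apply: (continuous_o (f := fun u : I * I => uival u.1) (g := fun r => 1 - r)).
    apply: (continuous_o (f := fun u : I * I => u.1)).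
      exact: continuous_fst'.
    exact: uival_continuous.
  by move=> r; apply: cvgB; [exact: cvg_cst|exact: cvg_id].
- by rewrite uival_zero subr0 clip1.
- by rewrite uival_one subrr clip0.
- exact: Hxy.
Qed.

(* Pastes two homotopies along the line where the coordinate [a] is [1/2]. *)
Local Lemma continuous_halves (a b : I * I -> I) (H K : I * I -> T)
    (h : I -> I -> I * I) :
  continuous a -> continuous b -> continuous (fun u : I * I => h u.1 u.2) ->
  continuous H -> continuous K -> (forall t, H (h one t) = K (h zero t)) ->
  continuous (fun u => if uival (a u) <= 2^-1
    then H (h (clip (uival (a u) * 2)) (b u))
    else K (h (clip (uival (a u) * 2 - 1)) (b u))).
Proof.
move=> ca cb ch cH cK HK.
have cav : continuous (fun u => uival (a u)).
  by apply: (continuous_o ca); exact: uival_continuous.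
have aux (k : R -> R) : continuous k ->
    continuous (fun u => h (clip (k (uival (a u)))) (b u)).
  move=> ck.
  apply: (continuous_o (f := fun u => (clip (k (uival (a u))), b u))) ch.
  apply: continuous_pair cb.
  apply: (continuous_o (f := fun u => k (uival (a u)))).
    exact: (continuous_o cav ck).
  exact: clip_continuous.
apply: (paste_continuous cav).
- apply: (continuous_o _ cH); apply: (aux (fun r => r * 2)) => r.
  exact: cvgM cvg_id (cvg_cst _).
- apply: (continuous_o _ cK); apply: (aux (fun r => r * 2 - 1)) => r.
  by apply: cvgB; [exact: cvgM cvg_id (cvg_cst _)|exact: cvg_cst].
- move=> u ->; rewrite mulVf ?pnatr_eq0// subrr.
  by rewrite (clip0 (lexx 0)) (clip1 (lexx 1)).
Qed.

Lemma path_homotopic_trans x y (p q r : {path I from x to y in T}) :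
  path_homotopic p q -> path_homotopic q r -> path_homotopic p r.
Proof.
move=> [H [cH H0 H1 Hxy]] [K [cK K0 K1 Kxy]].
exists (fun u => if uival u.1 <= 2^-1 then H (clip (uival u.1 * 2), u.2)
                 else K (clip (uival u.1 * 2 - 1), u.2)).
split=> [|t|t|s] /=.
- apply: (continuous_halves (h := fun s t => (s, t))) => //.
  + exact: continuous_fst'.
  + exact: continuous_snd'.
  + by apply: continuous_pair; [exact: continuous_fst'|exact: continuous_snd'].
  + by move=> t; rewrite H1 K0.
- by rewrite uival_zero invr_ge0 ler0n mul0r clip0.
- rewrite uival_one mul1r ifF; last by apply/negbTE; rewrite -ltNge; lra.
  by rewrite clip1 //; lra.
- have [? ?] := Hxy (clip (uival s * 2)).
  by have [? ?] := Kxy (clip (uival s * 2 - 1)); case: ifP.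
Qed.

Lemma path_cat_homotopic x y z (p p' : {path I from x to y in T})
    (q q' : {path I from y to z in T}) :
  path_homotopic p p' -> path_homotopic q q' ->
  path_homotopic (path_cat p q) (path_cat p' q').
Proof.
move=> [H [cH H0 H1 Hxy]] [K [cK K0 K1 Kxy]].
exists (fun u => if uival u.2 <= 2^-1 then H (u.1, clip (uival u.2 * 2))
                 else K (u.1, clip (uival u.2 * 2 - 1))).
split=> [|t|t|s] /=.
- apply: (continuous_halves (h := fun s t => (t, s))) => //.
  + exact: continuous_snd'.
  + exact: continuous_fst'.
  + by apply: continuous_pair; [exact: continuous_snd'|exact: continuous_fst'].
  + by move=> t; rewrite (Hxy t).2 (Kxy t).1.
- by rewrite H0 K0.
- by rewrite H1 K1.
- split.
    by rewrite uival_zero invr_ge0 ler0n mul0r clip0// (Hxy s).1.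
  rewrite uival_one mul1r ifF; last by apply/negbTE; rewrite -ltNge; lra.
  by rewrite clip1 ?(Kxy s).2 //; lra.
Qed.

Lemma path_rev_homotopic x y (p p' : {path I from x to y in T}) :
  path_homotopic p p' -> path_homotopic (path_rev p) (path_rev p').
Proof.
move=> [H [cH H0 H1 Hxy]]; exists (fun u => H (u.1, clip (1 - uival u.2))).
split=> [|t|t|s] /=.
- apply: (continuous_o (f := fun u : I * I => (u.1, clip (1 - uival u.2)))) cH.
  apply: continuous_pair; first exact: continuous_fst'.
  apply: (continuous_o (f := fun u : I * I => 1 - uival u.2)); last first.
    exact: clip_continuous.
  apply: (continuous_o (f := fun u : I * I => uival u.2) (g := fun r => 1 - r)).
    apply: (continuous_o (f := fun u : I * I => u.2)).
      exact: continuous_snd'.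
    exact: uival_continuous.
  by move=> r; apply: cvgB; [exact: cvg_cst|exact: cvg_id].
- by rewrite H0.
- by rewrite H1.
- rewrite uival_zero uival_one subr0 subrr (clip0 (lexx 0)) (clip1 (lexx 1)).
  by have [] := Hxy s.
Qed.

(* Two reparametrizations of the same path, with the same endpoints. *)
Lemma reparam_homotopic x y x' y' (p : {path I from x' to y' in T})
    (q1 q2 : {path I from x to y in T}) (f g : R -> R) :
  continuous f -> continuous g -> f 0 = g 0 -> f 1 = g 1 ->
  (forall u, 0 <= u <= 1 -> q1 (clip u) = p (clip (f u))) ->
  (forall u, 0 <= u <= 1 -> q2 (clip u) = p (clip (g u))) ->
  path_homotopic q1 q2.
Proof.
move=> cf cg fg0 fg1 q1E q2E.
pose h (v : R * R) : R := f v.2 + v.1 * (g v.2 - f v.2).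
have ch : continuous h.
  move=> v; apply: cvgD.
    by apply: (continuous_o _ cf); exact: continuous_snd'.
  apply: cvgM; first exact: continuous_fst'.
  apply: cvgB.
    by apply: (continuous_o _ cg); exact: continuous_snd'.
  by apply: (continuous_o _ cf); exact: continuous_snd'.
have qE (q : {path I from x to y in T}) k :
    (forall u, 0 <= u <= 1 -> q (clip u) = p (clip (k u))) ->
    forall t, q t = p (clip (k (uival t))).
  by move=> qk t; rewrite -qk ?uival_itv// clipK.
exists (fun u => p (clip (h (uival u.1, uival u.2)))); split=> [|t|t|s] /=.
- apply: (continuous_o (g := p)); last exact: cts_fun.
  apply: (continuous_o (f := fun u : I * I => h (uival u.1, uival u.2))).
    apply: (continuous_o (f := fun u : I * I => (uival u.1, uival u.2))) ch.
    apply: continuous_pair.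
      apply: (continuous_o (f := fun u : I * I => u.1)).
        exact: continuous_fst'.
      exact: uival_continuous.
    apply: (continuous_o (f := fun u : I * I => u.2)).
      exact: continuous_snd'.
    exact: uival_continuous.
  exact: clip_continuous.
- by rewrite /h uival_zero /= mul0r addr0 (qE _ _ q1E).
- by rewrite /h uival_one /= mul1r addrC subrK (qE _ _ q2E).
- rewrite /h uival_zero uival_one /= -fg0 -fg1 !subrr !mulr0 !addr0.
  rewrite -{1}uival_zero -{1}uival_one -!(qE _ _ q1E).
  by rewrite path_zero path_one.
Qed.

Local Lemma continuous_maxr (f g : R -> R) :
  continuous f -> continuous g -> continuous (fun r => Num.max (f r) (g r)).
Proof. by move=> cf cg r; apply: continuous_max; [exact: cf|exact: cg]. Qed.

Local Lemma continuous_minr (f g : R -> R) :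
  continuous f -> continuous g -> continuous (fun r => Num.min (f r) (g r)).
Proof. by move=> cf cg r; apply: continuous_min; [exact: cf|exact: cg]. Qed.

Local Lemma continuous_affine (a b : R) : continuous (fun r : R => r * a + b).
Proof.
by move=> r; apply: cvgD; [exact: cvgM cvg_id (cvg_cst _)|exact: cvg_cst].
Qed.

Lemma path_cat1p x y (p : {path I from x to y in T}) :
  path_homotopic (path_cat (path_cst x) p) p.
Proof.
apply: (reparam_homotopic (p := p) (f := fun r => Num.max (r * 0 + 0) (r * 2 + -1))
  (g := fun r => r * 1 + 0)).
- by apply: continuous_maxr; exact: continuous_affine.
- exact: continuous_affine.
- by apply/eqP; rewrite eq_le ge_max le_max; lra.
- by apply/eqP; rewrite eq_le ge_max le_max; lra.
- move=> u u01; rewrite path_catE //; case: ifPn => u2.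
    by rewrite [in RHS]clip0 ?path_zero // ge_max; lra.
  by rewrite (@max_r _ _ (u * 0 + 0)) //; rewrite -ltNge in u2; lra.
- by move=> u u01; rewrite mulr1 addr0.
Qed.

Lemma path_catp1 x y (p : {path I from x to y in T}) :
  path_homotopic (path_cat p (path_cst y)) p.
Proof.
apply: (reparam_homotopic (p := p) (f := fun r => Num.min (r * 2 + 0) (r * 0 + 1))
  (g := fun r => r * 1 + 0)).
- by apply: continuous_minr; exact: continuous_affine.
- exact: continuous_affine.
- by apply/eqP; rewrite eq_le ge_min le_min; lra.
- by apply/eqP; rewrite eq_le ge_min le_min; lra.
- move=> u u01; rewrite path_catE //; case: ifPn => u2.
    by rewrite (@min_l _ _ (u * 2 + 0)) ?addr0 //; lra.
  by rewrite [in RHS]clip1 ?path_one // le_min; rewrite -ltNge in u2; lra.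
- by move=> u u01; rewrite mulr1 addr0.
Qed.

Lemma path_catpV x y (p : {path I from x to y in T}) :
  path_homotopic (path_cat p (path_rev p)) (path_cst x).
Proof.
apply: (reparam_homotopic (p := p) (f := fun r => Num.min (r * 2 + 0) (r * -2 + 2))
  (g := fun r => r * 0 + 0)).
- by apply: continuous_minr; exact: continuous_affine.
- exact: continuous_affine.
- by apply/eqP; rewrite eq_le ge_min le_min; lra.
- by apply/eqP; rewrite eq_le ge_min le_min; lra.
- move=> u u01; rewrite path_catE //; case: ifPn => u2.
    by rewrite (@min_l _ _ (u * 2 + 0)) ?addr0 //; lra.
  rewrite -ltNge in u2; rewrite (@min_r _ _ (u * 2 + 0)); last lra.
  rewrite -[LHS]/(p (clip (1 - uival (clip (u * 2 - 1))))) uival_clip_id; last lra.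
  by congr (p (clip _)); lra.
- by move=> u u01; rewrite mulr0 addr0 [in RHS]clip0 ?path_zero.
Qed.

Lemma path_catVp x y (p : {path I from x to y in T}) :
  path_homotopic (path_cat (path_rev p) p) (path_cst y).
Proof.
apply: (reparam_homotopic (p := p) (f := fun r => Num.max (r * -2 + 1) (r * 2 + -1))
  (g := fun r => r * 0 + 1)).
- by apply: continuous_maxr; exact: continuous_affine.
- exact: continuous_affine.
- by apply/eqP; rewrite eq_le ge_max le_max; lra.
- by apply/eqP; rewrite eq_le ge_max le_max; lra.
- move=> u u01; rewrite path_catE //; case: ifPn => u2.
    rewrite (@max_l _ _ (u * -2 + 1)); last lra.
    rewrite -[LHS]/(p (clip (1 - uival (clip (u * 2))))) uival_clip_id; last lra.
    by congr (p (clip _)); lra.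
  by rewrite -ltNge in u2; rewrite (@max_r _ _ (u * -2 + 1)) //; lra.
- by move=> u u01; rewrite mulr0 add0r [in RHS]clip1 ?path_one.
Qed.

Lemma path_catA w x y z (p : {path I from w to x in T})
    (q : {path I from x to y in T}) (r : {path I from y to z in T}) :
  path_homotopic (path_cat p (path_cat q r)) (path_cat (path_cat p q) r).
Proof.
apply: (reparam_homotopic (p := path_cat p (path_cat q r))
  (f := fun r => r * 1 + 0)
  (g := fun r => Num.min (r * 2 + 0)
                   (Num.min (r * 1 + 4^-1) (r * 2^-1 + 2^-1)))).
- exact: continuous_affine.
- do 2?[apply: continuous_minr; first exact: continuous_affine].
  exact: continuous_affine.
- by apply/eqP; rewrite eq_le !ge_min !le_min; lra.
- by apply/eqP; rewrite eq_le !ge_min !le_min; lra.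
- by move=> u u01; rewrite mulr1 addr0.
move=> u u01; rewrite path_catE //; case: ifPn => u2; last rewrite -ltNge in u2.
  rewrite path_catE; last lra.
  case: ifPn => u4; last rewrite -ltNge in u4.
    rewrite (@min_l _ _ (u * 2 + 0)); last by rewrite le_min; lra.
    by rewrite path_catE ?addr0 ?u4 //; lra.
  rewrite (@min_r _ _ (u * 2 + 0)); last by rewrite ge_min; lra.
  rewrite (@min_l _ _ (u * 1 + 4^-1)); last lra.
  rewrite path_catE ?ifF; [|by apply/negbTE; rewrite -ltNge; lra|lra].
  rewrite path_catE ?ifT; [|lra|lra].
  by congr (q (clip _)); lra.
rewrite (@min_r _ _ (u * 2 + 0)); last by rewrite ge_min; lra.
rewrite (@min_r _ _ (u * 1 + 4^-1)); last lra.
rewrite path_catE ?ifF; [|by apply/negbTE; rewrite -ltNge; lra|lra].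
rewrite path_catE ?ifF; [|by apply/negbTE; rewrite -ltNge; lra|lra].
by congr (r (clip _)); lra.
Qed.

End Homotopy.

Section FundamentalGroup.
Variables (R : realType) (T : topologicalType) (x : T).
Local Notation loop := {path unit_interval R from x to x in T}.

Let hom (p q : loop) : bool := `[< path_homotopic p q >].

Local Lemma hom_refl : reflexive hom.
Proof. by move=> p; apply/asboolP/path_homotopic_refl. Qed.

Local Lemma hom_sym : symmetric hom.
Proof. by move=> p q; apply/asboolP/asboolP; exact: path_homotopic_sym. Qed.

Local Lemma hom_trans : transitive hom.
Proof.
by move=> q p r /asboolP pq /asboolP qr; apply/asboolP/(path_homotopic_trans pq).
Qed.

Definition homotopy_equiv := EquivRel hom hom_refl hom_sym hom_trans.

Definition pi1 := {eq_quot homotopy_equiv}.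

HB.instance Definition _ := Choice.on pi1.
HB.instance Definition _ := Quotient.on pi1.

Definition pi1_class (p : loop) : pi1 := \pi_pi1 p.

Lemma pi1_classP p q : pi1_class p = pi1_class q <-> path_homotopic p q.
Proof. by split=> [/eqmodP/asboolP //|pq]; apply/eqmodP/asboolP. Qed.

Lemma pi1_repr (a : pi1) : pi1_class (repr a) = a.
Proof. exact: reprK. Qed.

Lemma repr_pi1_class p : path_homotopic (repr (pi1_class p)) p.
Proof. by apply/pi1_classP; rewrite pi1_repr. Qed.

Definition pi1_mul (a b : pi1) : pi1 := pi1_class (path_cat (repr a) (repr b)).

Definition pi1_inv (a : pi1) : pi1 := pi1_class (path_rev (repr a)).

Definition pi1_one : pi1 := pi1_class (path_cst x).

Local Lemma pi1_mulE p q :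
  pi1_mul (pi1_class p) (pi1_class q) = pi1_class (path_cat p q).
Proof. by apply/pi1_classP/path_cat_homotopic; exact: repr_pi1_class. Qed.

Local Lemma pi1_invE p : pi1_inv (pi1_class p) = pi1_class (path_rev p).
Proof. by apply/pi1_classP/path_rev_homotopic; exact: repr_pi1_class. Qed.

Local Lemma pi1_mulA : associative pi1_mul.
Proof.
move=> a b c; rewrite -(pi1_repr a) -(pi1_repr b) -(pi1_repr c) !pi1_mulE.
exact/pi1_classP/path_catA.
Qed.

Local Lemma pi1_mul1 : left_id pi1_one pi1_mul.
Proof.
by move=> a; rewrite -(pi1_repr a) pi1_mulE; apply/pi1_classP/path_cat1p.
Qed.

Local Lemma pi1_mulr1 : right_id pi1_one pi1_mul.
Proof.
by move=> a; rewrite -(pi1_repr a) pi1_mulE; apply/pi1_classP/path_catp1.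
Qed.

Local Lemma pi1_mulV : left_inverse pi1_one pi1_inv pi1_mul.
Proof.
move=> a; rewrite -(pi1_repr a) pi1_invE pi1_mulE.
exact/pi1_classP/path_catVp.
Qed.

Local Lemma pi1_mulrV : right_inverse pi1_one pi1_inv pi1_mul.
Proof.
move=> a; rewrite -(pi1_repr a) pi1_invE pi1_mulE.
exact/pi1_classP/path_catpV.
Qed.

HB.instance Definition _ := isGroup.Build pi1
  pi1_mulA pi1_mul1 pi1_mulr1 pi1_mulV pi1_mulrV.

Lemma pi1_classM p q :
  (pi1_class p * pi1_class q)%g = pi1_class (path_cat p q).
Proof. exact: pi1_mulE. Qed.

Lemma pi1_classV p : (pi1_class p)^-1%g = pi1_class (path_rev p).
Proof. exact: pi1_invE. Qed.

Lemma pi1_class1 : pi1_class (path_cst x) = 1%g.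
Proof. by []. Qed.

End FundamentalGroup.

Section InducedMap.
Variables (R : realType) (T U : topologicalType) (f : continuousType T U).
Variable x : T.

Definition pi1_map (a : pi1 R x) : pi1 R (f x) :=
  pi1_class (f \o repr a : {path unit_interval R from f x to f x in U}).

Lemma pi1_map_class (p : {path unit_interval R from x to x in T}) :
  pi1_map (pi1_class p) =
  pi1_class (f \o p : {path unit_interval R from f x to f x in U}).
Proof.
apply/pi1_classP.
have [H [cH H0 H1 Hx]] := repr_pi1_class p.
exists (f \o H); split=> [|t|t|s] /=; rewrite ?H0 ?H1 //; last first.
  by have [-> ->] := Hx s.
by apply: (continuous_o cH); exact: cts_fun.
Qed.

End InducedMap.

(** * The torus and its linear loops *)

Section Torus.
Variable R : realType.
Local Notation I := (unit_interval R).

Definition circle := @quot R (fun a b => exists m : int, b = a + m%:~R).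

HB.instance Definition _ := Topological.on circle.
HB.instance Definition _ := Quotient.on circle.

Definition circle_pi (a : R) : circle := quot_pi _ a.

Definition torus : Type := (circle * circle)%type.

HB.instance Definition _ := Topological.on torus.

Section line.
Variables (x : torus) (n : 'cV[int]_2).

Definition torus_line_fun (t : I) : torus :=
  (circle_pi (repr x.1 + uival t * (n 0 0)%:~R),
   circle_pi (repr x.2 + uival t * (n 1 0)%:~R)).

Local Lemma torus_line_continuous : continuous torus_line_fun.
Proof.
apply: (continuous_pair
  (f := fun t : I => circle_pi (repr x.1 + uival t * (n 0 0)%:~R))
  (g := fun t : I => circle_pi (repr x.2 + uival t * (n 1 0)%:~R))).
  apply: (continuous_o (f := fun t : I => repr x.1 + uival t * (n 0 0)%:~R)
    (g := circle_pi)); last exact: quot_pi_continuous.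
  apply: (continuous_o (g := fun r : R => repr x.1 + r * (n 0 0)%:~R)
    (@uival_continuous R)) => r.
  by apply: cvgD; [exact: cvg_cst|exact: cvgM cvg_id (cvg_cst _)].
apply: (continuous_o (f := fun t : I => repr x.2 + uival t * (n 1 0)%:~R)
  (g := circle_pi)); last exact: quot_pi_continuous.
apply: (continuous_o (g := fun r : R => repr x.2 + r * (n 1 0)%:~R)
  (@uival_continuous R)) => r.
by apply: cvgD; [exact: cvg_cst|exact: cvgM cvg_id (cvg_cst _)].
Qed.

Local Lemma circle_repr (y : circle) : circle_pi (repr y) = y.
Proof. exact: reprK. Qed.

Local Lemma circle_piD (a : R) (m : int) : circle_pi (a + m%:~R) = circle_pi a.
Proof. by apply/esym/quot_piP/rst_step; exists m. Qed.

Local Lemma torus_line_zero : torus_line_fun zero = x.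
Proof.
rewrite /torus_line_fun uival_zero !mul0r !addr0 !circle_repr.
by case: (x).
Qed.

Local Lemma torus_line_one : torus_line_fun one = x.
Proof.
rewrite /torus_line_fun uival_one !mul1r !circle_piD !circle_repr.
by case: (x).
Qed.

(* The loop at [x] that is the image of a straight segment with direction the
   integer vector [n]; [n |-> pi1_class (torus_line x n)] is the standard
   identification of Z^2 with the fundamental group of the torus at [x]. *)
Definition torus_line : {path I from x to x in torus} :=
  mk_path torus_line_continuous torus_line_zero torus_line_one.

End line.

(* The fundamental group of the torus being abelian, its identification with
   Z^2 does not depend on the base point, and the action of [f] is given by a
   matrix even when [f] has no fixed point. *)
Definition acts_on_pi1_by (f : continuousType torus torus) (A : 'M[int]_2) :=
  forall (x : torus) (n : 'cV[int]_2),
    pi1_map f (pi1_class (torus_line x n)) =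
    pi1_class (torus_line (f x) (A *m n)).

(** * Anosov bundles and Anosov doubles *)

(* Torus bundle over the circle with monodromy [f]: (y, 1) is glued to
   (f y, 0). *)
Definition mapping_torus (f : torus -> torus) :=
  @quot (torus * I)%type
    (fun p q => [/\ p.2 = one, q.2 = zero & q.1 = f p.1]).

HB.instance Definition _ f := Topological.on (mapping_torus f).

Definition Anosov_bundle (M : topologicalType) :=
  exists (f : continuousType torus torus) (A : 'M[int]_2),
    [/\ homeomorphism f, \det A = 1, 2 < `|\tr A|, acts_on_pi1_by f A
      & homeomorphic M (mapping_torus f)].

(* The involution s (a, b) = (a + 1/2, - b) of the torus is free and reverses
   the orientation, so that its quotient is the Klein bottle. The quotient of
   torus * [0, 1] by the free, orientation preserving involution
   (y, t) |-> (s y, 1 - t) is thus an interval bundle over the Klein bottle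
   whose total space is orientable. *)
Definition twisted_Ibundle :=
  @quot (torus * I)%type (fun p q => exists a b : R,
    [/\ p.1 = (circle_pi a, circle_pi b),
        q.1 = (circle_pi (a + 2^-1), circle_pi (- b))
      & uival q.2 = 1 - uival p.2]).

HB.instance Definition _ := Topological.on twisted_Ibundle.

(* The two ends of torus * [0, 1] are exchanged by the involution, so this
   identifies the torus with the boundary of [twisted_Ibundle]. *)
Definition Ibundle_boundary (y : torus) : twisted_Ibundle :=
  quot_pi _ (y, one : I).

(* Two copies, tagged by a boolean, glued along their boundary tori by [h]. *)
Definition Ibundle_double (h : torus -> torus) :=
  @quot (twisted_Ibundle * bool)%type (fun p q => exists y : torus,
    p = (Ibundle_boundary y, true) /\ q = (Ibundle_boundary (h y), false)).

HB.instance Definition _ h := Topological.on (Ibundle_double h).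

Definition Anosov_double (M : topologicalType) :=
  (exists h : torus -> torus,
     homeomorphism h /\ homeomorphic M (Ibundle_double h)) /\
  exists (E : topologicalType) (p : E -> M),
    [/\ Anosov_bundle E, double_covering p & ~ trivial_double_covering p].

End Torus.

(* Main.v *)
(* A Sol manifold group G contains, with index at most two, a semidirect product
   H = Z^2 x| <t> in which t acts on Z^2 by the hyperbolic matrix A. A pointwise
   inner map phi may be assumed to fix t; it then acts on Z^2 by a matrix B that
   commutes with A. If B agrees with a power of A at one nonzero vector, then B is
   that power by irreducibility of A, so phi is conjugation by a power of t on H,
   hence on G. Otherwise B v = C A^k(v) v for every v, where C is the action of some
   c outside H, and C A C^-1 is A^-1 or A. The first case is impossible since the
   A-invariant quadratic form det(v, A v) takes infinitely many values on primitive
   vectors. In the second case either some c t^-i is, up to a translation, a square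
   root of t, and the first argument applies to it in place of t, or C = - A^i, which
   is settled by comparing the conjugacy classes of t v and t^2 v with those of their
   images.

   For a closed manifold M, lift loops along R^2 x R -> T^2 x R -> mapping torus -> M,
   where the last map is a homeomorphism or a two-sheeted covering: loops are
   homotopic if and only if their lifts have the same endpoint. The double covering
   by an Anosov bundle is all that is used of an Anosov double. *)

Require Import Defs.
From Stdlib Require Import Relations.
From mathcomp Require Import all_boot all_order all_algebra.
From mathcomp Require Import all_classical all_reals.
From mathcomp Require Import topology normedtype continuous_path.
From mathcomp Require Import ring lra zify.

Set Implicit Arguments.
Unset Strict Implicit.
Unset Printing Implicit Defensive.

Import Order.TTheory GRing.Theory Num.Theory.
Import numFieldNormedType.Exports.

Local Open Scope ring_scope.

(** * Two-by-two integer matrices *)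

Section Mat2.
Implicit Types (u v w : 'cV[int]_2) (B C : 'M[int]_2).

(** The determinant with columns [u] and [v]: nonzero exactly for independent vectors. *)
Definition omega u v : int := u 0 0 * v 1 0 - u 1 0 * v 0 0.

Lemma omegaZ (a : int) u v : omega u (a *: v) = a * omega u v.
Proof. by rewrite /omega !mxE; ring. Qed.

Lemma mulmx2 B v i : (B *m v) i 0 = B i 0 * v 0 0 + B i 1 * v 1 0.
Proof.
rewrite mxE !big_ord_recl big_ord0 addr0.
by congr (_ + B i _ * v _ 0); apply: val_inj.
Qed.

Lemma ord2P (P : 'I_2 -> Prop) : P 0 -> P 1 -> forall i, P i.
Proof.
move=> P0 P1 i.
by have /orP[/eqP ->|/eqP ->] : (i == 0) || (i == 1) by case: i => [[|[]]].
Qed.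

Lemma cV2P u v : u 0 0 = v 0 0 -> u 1 0 = v 1 0 -> u = v.
Proof. by move=> h0 h1; apply/matrixP => i j; rewrite ord1; elim/ord2P: i. Qed.

Lemma mx2P B C : (forall v, B *m v = C *m v) -> B = C.
Proof.
move=> BC; apply/matrixP => i j.
have := congr1 (fun v : 'cV_2 => v i 0) (BC (delta_mx j 0)).
by rewrite !mulmx2 !mxE; elim/ord2P: j => /=; rewrite !mulr1 !mulr0 ?addr0 ?add0r.
Qed.

Lemma det2 B : \det B = B 0 0 * B 1 1 - B 0 1 * B 1 0.
Proof.
rewrite (expand_det_row _ ord0) !big_ord_recl big_ord0 /cofactor !det_mx11 !mxE /=.
rewrite expr0 expr1 mul1r mulN1r addr0 mulrN.
by congr (B _ _ * B _ _ - B _ _ * B _ _); apply: val_inj.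
Qed.

Lemma tr2 B : \tr B = B 0 0 + B 1 1.
Proof.
rewrite /mxtrace !big_ord_recl big_ord0 addr0.
by congr (B _ _ + B _ _); apply: val_inj.
Qed.

Lemma omega_mul B u v : omega (B *m u) (B *m v) = \det B * omega u v.
Proof. by rewrite /omega !mulmx2 det2; ring. Qed.

(* Two vectors with nonzero determinant are a basis over the rationals. *)
Lemma ker_omega B u v : B *m u = 0 -> B *m v = 0 -> omega u v != 0 -> B = 0.
Proof.
move=> Bu Bv uv; apply/matrixP => i j; rewrite mxE.
have := congr1 (fun w : 'cV_2 => w i 0) Bu; have := congr1 (fun w : 'cV_2 => w i 0) Bv.
rewrite !mulmx2 !mxE /= => hv hu.
have h0 : B i 0 * omega u v = 0.
  transitivity ((B i 0 * u 0 0 + B i 1 * u 1 0) * v 1 0 -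
    (B i 0 * v 0 0 + B i 1 * v 1 0) * u 1 0); first by rewrite /omega; ring.
  by rewrite hu hv !mul0r subrr.
have h1 : B i 1 * omega u v = 0.
  transitivity ((B i 0 * v 0 0 + B i 1 * v 1 0) * u 0 0 -
    (B i 0 * u 0 0 + B i 1 * u 1 0) * v 0 0); first by rewrite /omega; ring.
  by rewrite hu hv !mul0r subrr.
move/eqP: h0; move/eqP: h1; rewrite !mulf_eq0 (negPf uv) !orbF => /eqP h1 /eqP h0.
by elim/ord2P: j.
Qed.

(** Additivity gives compatibility with integer scalars, by induction in both directions; the
    columns are the images of the basis vectors. *)
Lemma additive_mx (F : 'cV[int]_2 -> 'cV[int]_2) : {morph F : u v / u + v} ->
  exists B, forall v, F v = B *m v.
Proof.
move=> FD; have F0 : F 0 = 0 by apply: (@addrI _ (F 0)); rewrite -FD !addr0.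
have FZ (z : int) v : F (z *: v) = z *: F v.
  elim/int_ind: z => [|n IH|n IH]; first by rewrite !scale0r.
    by rewrite intS !scalerDl !scale1r FD IH.
  have e : - n%:Z = - n.+1%:Z + 1 by lia.
  by move: IH; rewrite e !scalerDl !scale1r FD => /addIr.
exists (\matrix_(i, j) F (delta_mx j 0) i 0) => v.
have vE : v = v 0 0 *: delta_mx 0 0 + v 1 0 *: delta_mx 1 0.
  by apply: cV2P; rewrite !mxE /= ?mulr1 ?mulr0 ?addr0 ?add0r.
rewrite {1}vE FD !FZ; apply/matrixP => i j; rewrite ord1 mulmx2 !mxE.
by rewrite [v 0 0 * _]mulrC [v 1 0 * _]mulrC.
Qed.

(** [C] is the geometric sum, continued to negative exponents. *)
Lemma expz_sub1 (B : 'M[int]_2) (k : int) : B \is a GRing.unit ->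
  exists C, B ^ k - 1 = (B - 1) *m C.
Proof.
move=> uB; elim/int_ind: k => [|n [C BC]|n [C BC]].
- by exists 0; rewrite expr0z subrr mulmx0.
- exists (B ^ n + C); rewrite mulmxDr -BC mulmxBl mul1mx addrA; congr (_ - 1).
  by rewrite intS exprzDr// expr1z subrK.
- exists (C - B ^ (- n.+1%:Z)); rewrite mulmxBr -BC mulmxBl mul1mx.
  have -> : B *m B ^ (- n.+1%:Z) = B ^ (- n%:Z).
    rewrite -[B *m _]/(B * _) -{1}[B]expr1z -exprzDr//; congr (_ ^ _); lia.
  by rewrite opprB [RHS]addrC addrA subrK.
Qed.

(** Halving the doubled basis vectors through [B] gives an integer matrix [C] with [B *m C = 2%:M];
    take determinants. *)
Lemma det_double (B : 'M[int]_2) : (forall v, exists w, v + v = B *m w) ->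
  exists k, 4 = \det B * k.
Proof.
move=> h; have /choice [F FP] : forall j : 'I_2, exists w,
    delta_mx j 0 + delta_mx j 0 = B *m w.
  by move=> j; exact: h.
pose C : 'M[int]_2 := \matrix_(i, j) F j i 0.
have BC : B *m C = 2%:M.
  apply/matrixP => i j; transitivity ((B *m F j) i 0).
    by rewrite !mxE; apply: eq_bigr => k _; rewrite mxE.
  by rewrite -FP !mxE; elim/ord2P: i; elim/ord2P: j.
by exists (\det C); rewrite -det_mulmx BC det_scalar expr2.
Qed.


End Mat2.

(** * Hyperbolic matrices of determinant one *)

Section Hyperbolic.
Variable A : 'M[int]_2.
Hypotheses (detA : \det A = 1) (trA : 2 < `|\tr A|).
Implicit Types (u v w : 'cV[int]_2) (B C : 'M[int]_2).

Definition qf v := omega v (A *m v).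

Lemma unitA : A \is a GRing.unit.
Proof. by rewrite -[_ \is a _]/(A \in unitmx) unitmxE detA unitr1. Qed.

(** For |T| > 2, [T ^+ 2 - 4] lies strictly between the squares of |T| - 1 and |T|, so it is not a
    square; a nonzero [y] would divide [x] and make it one. *)
Lemma square_factor (x y T : int) : 2 < `|T| -> x ^+ 2 = (T ^+ 2 - 4) * y ^+ 2 -> y = 0.
Proof.
move=> T2 xy; apply/eqP/negPn/negP => y0.
have /dvdzP [s xs] : (y %| x)%Z.
  rewrite dvdzE -(@dvdn_pexp2r _ _ 2)// -!abszX -dvdzE.
  by rewrite xy dvdz_mull.
move: xy; rewrite xs exprMn => /(mulIf (expf_neq0 2 y0)).
rewrite -[s ^+ 2]real_normK ?num_real// -[T ^+ 2]real_normK ?num_real// !expr2 => sT.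
have s0 := normr_ge0 s; set a := `|s| in sT s0 *; set b := `|T| in T2 sT *.
have ab : a < b by rewrite ltNge; apply/negP => ba; nia.
nia.
Qed.

Lemma qfE v :
  qf v = A 1 0 * v 0 0 ^+ 2 + (A 1 1 - A 0 0) * v 0 0 * v 1 0 - A 0 1 * v 1 0 ^+ 2.
Proof. by rewrite /qf /omega !mulmx2; ring. Qed.

(** A zero of [qf] would be an eigenvector. The discriminant of the form is [\tr A ^+ 2 - 4], not a
    square by [square_factor]. *)
Lemma qf_eq0 v : qf v = 0 -> v = 0.
Proof.
rewrite qfE => qv; have := detA; have := trA; rewrite det2 tr2 => T2 D1.
have v1 : v 1 0 = 0.
  apply: (@square_factor (2 * A 1 0 * v 0 0 + (A 1 1 - A 0 0) * v 1 0) _ _ T2).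
  set a := A 0 0 in D1 qv *; set b := A 0 1 in D1 qv *; set c := A 1 0 in D1 qv *.
  set e := A 1 1 in D1 qv *; set x := v 0 0 in qv *; set y := v 1 0 in qv *.
  (* Completing the square in [4 * c * qf v]. *)
  transitivity (4 * c * (c * x ^+ 2 + (e - a) * x * y - b * y ^+ 2) +
    ((a + e) ^+ 2 - 4 * (a * e - b * c)) * y ^+ 2); first by ring.
  by rewrite qv D1; ring.
have c0 : A 1 0 != 0.
  apply/negP => /eqP c0; rewrite c0 mulr0 subr0 in D1.
  have := @square_factor (A 0 0 - A 1 1) 1 _ T2.
  have -> : (A 0 0 - A 1 1) ^+ 2 = (A 0 0 + A 1 1) ^+ 2 - 4 * (A 0 0 * A 1 1) by ring.
  by rewrite D1 expr1n !mulr1 => /(_ erefl).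
apply: cV2P; rewrite mxE//.
move: qv; rewrite v1 expr0n /= !mulr0 subr0 addr0 => /eqP.
by rewrite mulf_eq0 (negPf c0) /= sqrf_eq0 => /eqP.
Qed.

(** The kernel of [B] is stable under [A], so it contains [v] and [A *m v], which are independent
    because [qf v] is nonzero. *)
Lemma comm_ker B v : A *m B = B *m A -> v != 0 -> B *m v = 0 -> B = 0.
Proof.
move=> AB v0 Bv; apply: (@ker_omega _ v (A *m v)) => //.
  by rewrite mulmxA -AB -mulmxA Bv mulmx0.
by apply: contra v0 => /eqP/qf_eq0 ->.
Qed.

Lemma comm_eq B C v : A *m B = B *m A -> A *m C = C *m A -> v != 0 ->
  B *m v = C *m v -> B = C.
Proof.
move=> AB AC v0 BC; apply/eqP; rewrite -subr_eq0; apply/eqP.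
by apply: (@comm_ker _ v) => //; rewrite ?mulmxBr ?mulmxBl ?AB ?AC// BC subrr.
Qed.

Lemma cayley2 : A *m A = \tr A *: A - 1.
Proof.
apply: mx2P => v; rewrite -mulmxA mulmxBl mul1mx -scalemxAl -[X in _ = _ - X]scale1r -detA.
by apply: cV2P; rewrite !(mulmx2, mxE) tr2 det2; ring.
Qed.

(** By Cayley-Hamilton a positive power is [x *: A + y%:M], and the trace bound keeps |y| < |x|. If
    it were scalar, so would be [x *: A], and [qf] would vanish at a basis vector. *)
Lemma exp_scalar (n : nat) (a : int) : A ^+ n = a%:M -> n = 0.
Proof.
case: n => // n An; exfalso.
have [x [y [xy AE]]] : exists x y : int, `|y| < `|x| /\ A ^+ n.+1 = x *: A + y%:M.
  elim: n {An} => [|n [x [y [xy AE]]]].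
    by exists 1, 0; split => //; rewrite expr1 scale1r raddf0 addr0.
  exists (x * \tr A + y), (- x); split.
    rewrite normrN; have : `|x * \tr A| <= `|x * \tr A + y| + `|y|.
      by rewrite -{1}[x * \tr A](addrK y) ler_normB.
    rewrite normrM; nia.
  rewrite exprS AE mulrDr -scalerAr -[A * A]/(A *m A) cayley2 scalerBr scalerA.
  rewrite -[A * y%:M]/(A *m y%:M) mul_mx_scalar scalerDl.
  by rewrite addrAC raddfN /= scalemx1.
pose e : 'cV[int]_2 := delta_mx 0 0.
have e0 : e != 0.
  by apply/negP => /eqP/(congr1 (fun v : 'cV_2 => v 0 0)); rewrite !mxE.
have qe : qf e != 0 by apply: contra e0 => /eqP/qf_eq0 ->.
have xA : x *: A = (a - y)%:M by rewrite raddfB /= -An AE addrK.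
have : x * qf e = 0.
  have -> : x * qf e = omega e ((x *: A) *m e).
    by rewrite -scalemxAl omegaZ.
  by rewrite xA mul_scalar_mx omegaZ /omega; ring.
move/eqP; rewrite mulf_eq0 (negPf qe) orbF => /eqP x0.
by move: xy; rewrite x0 normr0 ltNge normr_ge0.
Qed.

Lemma expz_eq1 (k : int) : A ^ k = 1 -> k = 0.
Proof.
case: k => n; first by move=> /(@exp_scalar n 1) ->.
rewrite NegzE -exprnN => /(congr1 (fun B : 'M_2 => B^-1)).
by rewrite invrK invr1 => /(@exp_scalar n.+1 1).
Qed.

Lemma comm_expz B (k : int) : A *m B = B *m A -> A ^ k *m B = B *m A ^ k.
Proof.
move=> AB; have : GRing.comm A B by [].
by move=> /commr_sym/(@commrXz _ B A k)/commr_sym.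
Qed.

Lemma expzS (k : int) v : A ^ (k + 1) *m v = A *m (A ^ k *m v).
Proof. by rewrite addrC exprzDr ?unitA// expr1z -[A * _]/(A *m _) mulmxA. Qed.

Lemma omega_expz (k : int) u v : omega (A ^ k *m u) (A ^ k *m v) = omega u v.
Proof.
have omegaA u' v' : omega (A *m u') (A *m v') = omega u' v'.
  by rewrite omega_mul detA mul1r.
elim/int_ind: k => [|n <-|n <-]; first by rewrite expr0z !mul1mx.
  by rewrite intS addrC !expzS omegaA.
rewrite -[in LHS]omegaA -!expzS.
by have -> : - n.+1%:Z + 1 = - n%:Z by lia.
Qed.

Lemma qf_expz (k : int) v : qf (A ^ k *m v) = qf v.
Proof. by rewrite /qf mulmxA -comm_expz// -mulmxA omega_expz. Qed.

(** Both vectors are primitive, as [u] and [u'] witness, so proportionality makes them equal up to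
    sign, and [qf] is even. *)
Lemma qf_proportional w w' u u' : omega w u = 1 -> omega w' u' = 1 ->
  omega w w' = 0 -> qf w' = qf w.
Proof.
move=> wu wu' ww'; have w'E : w' = omega w' u *: w.
  transitivity (omega w u *: w' - omega w w' *: u).
    by rewrite wu ww' scale1r scale0r subr0.
  by apply: cV2P; rewrite !mxE /omega; ring.
move: (omega w' u) w'E => a w'E.
have a1 : (a %| 1)%Z.
  apply/dvdzP; exists (omega w u'); rewrite -[LHS]wu' w'E /omega !mxE; ring.
have aa : a * a = 1 by move: a1; rewrite dvdz1 => /eqP a1; lia.
transitivity (a * a * qf w); last by rewrite aa mul1r.
by rewrite w'E !qfE !mxE; ring.
Qed.

(* The vectors on which [B] agrees with [C] (resp. with [C *m A]) span a line,
   so that up to sign only two primitive vectors remain modulo powers of [A];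
   but the quadratic form [qf], which is invariant under [A], takes infinitely
   many values on primitive vectors. *)
Lemma no_pointwise_reflection B C : A *m B = B *m A -> C \is a GRing.unit ->
  C *m A = A ^ (-1) *m C ->
  ~ (forall v, v != 0 -> exists k : int, B *m v = C *m (A ^ k *m v)).
Proof.
move=> AB uC CA h.
have AC : A *m C = C *m A ^ (-1).
  have e : A *m A ^ (-1) = 1%:M by exact: (divrr unitA).
  by rewrite -[C in LHS]mulmx1 -e !mulmxA -(mulmxA A) CA !mulmxA e mul1mx.
have CX (i : int) : A ^ i *m C = C *m A ^ (- i).
  elim/int_ind: i => [|n IH|n IH]; first by rewrite oppr0 expr0z mulmx1 mul1mx.
    rewrite intS exprzDr ?unitA// expr1z -[A * _]/(A *m _) -mulmxA IH mulmxA AC -mulmxA.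
    by rewrite opprD [in RHS]exprzDr ?unitA.
  rewrite intS opprD exprzDr ?unitA// -[A ^ (-1) * _]/(A ^ (-1) *m _).
  rewrite -mulmxA IH mulmxA -CA -mulmxA.
  by rewrite opprD !opprK [in RHS]exprzDr ?unitA// expr1z.
pose cls (r : bool) w := B *m w = C *m (A ^ (r : int) *m w).
(* Since [C] inverts [A], replacing [v] by [A ^ i *m v] turns the exponent [k] into [k - 2 * i]:
   only its parity [r] matters. *)
have reduce v : v != 0 -> exists (i : int) r, cls r (A ^ i *m v).
  move=> v0; have [k vk] := h v v0.
  have [i [r kE]] : exists (i : int) (r : bool), k - i = r%:Z + i.
    exists (k %/ 2)%Z, ((k %% 2)%Z == 1); lia.
  exists i, r; rewrite /cls.
  have -> : B *m (A ^ i *m v) = A ^ i *m (B *m v).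
    by rewrite !mulmxA (comm_expz i AB).
  rewrite vk (mulmxA (A ^ i)) CX -mulmxA; congr (C *m _).
  rewrite (mulmxA (A ^ _)) (mulmxA (A ^ r)).
  by congr (_ *m v); rewrite -[LHS]/(_ * _) -[RHS]/(_ * _) -!exprzDr ?unitA// -kE addrC.
(* Otherwise [B] commutes with [A] while [C] inverts it, which gives [A ^ 2 = 1]. *)
have neq r : B - C *m A ^ (r : int) != 0.
  apply/negP; rewrite subr_eq0 => /eqP BE.
  have e1 : C *m A ^ (-1 + (r : int)) = A *m (C *m A ^ (r : int)).
    by rewrite mulmxA AC -mulmxA; congr (_ *m _); apply: exprzDr; exact: unitA.
  have e2 : C *m A ^ ((r : int) + 1) = C *m A ^ (r : int) *m A.
    by rewrite -mulmxA; congr (_ *m _); rewrite exprzDr ?unitA// expr1z.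
  have /(mulrI uC) e3 : C * A ^ (-1 + (r : int)) = C * A ^ ((r : int) + 1).
    by apply: etrans e1 (etrans _ (esym e2)); rewrite -BE.
  have := congr1 (fun X => A ^ (1 - (r : int)) * X) e3; rewrite /= -!exprzDr ?unitA//.
  have -> : 1 - (r : int) + (-1 + (r : int)) = 0 by lia.
  by rewrite expr0z => /esym/expz_eq1; lia.
have parallel r w w' : cls r w -> cls r w' -> omega w w' = 0.
  move=> cw cw'; apply/eqP; apply: contraT => ww'; case/eqP: (neq r).
  by apply: (ker_omega _ _ ww'); rewrite mulmxBl -mulmxA; apply/eqP; rewrite subr_eq0; apply/eqP.
(* The vectors (x, 1) are primitive: their determinant with [u] is 1. *)
pose vx (x : int) : 'cV[int]_2 := \col_i if i == 0 then x else 1.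
pose u : 'cV[int]_2 := \col_i if i == 0 then -1 else 0.
have vx0 x : vx x != 0.
  by apply/negP => /eqP/(congr1 (fun v : 'cV_2 => v 1 0)); rewrite !mxE.
have vxu x : omega (vx x) u = 1 by rewrite /omega !mxE /=; ring.
pose hit r x := exists i : int, cls r (A ^ i *m vx x).
have hitq r x y : hit r x -> hit r y -> qf (vx x) = qf (vx y).
  move=> [i ci] [j cj]; rewrite -(qf_expz i) -(qf_expz j (vx y)).
  apply: (@qf_proportional _ _ (A ^ j *m u) (A ^ i *m u)); rewrite ?omega_expz//.
  exact: parallel cj ci.
have [k kP] : exists k : bool -> int, forall x, qf (vx x) = k true \/ qf (vx x) = k false.
  have /choice [k kP] : forall r : bool, exists k, forall x, hit r x -> qf (vx x) = k.
    move=> r; have [[y hy]|no] := pselect (exists y, hit r y).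
      by exists (qf (vx y)) => x hx; exact: hitq hx hy.
    by exists 0 => x hx; case: no; exists x.
  exists k => x; have [i [[] ci]] := reduce _ (vx0 x).
    by left; apply: kP; exists i.
  by right; apply: kP; exists i.
have c0 : A 1 0 != 0.
  apply/negP => /eqP c0; pose e : 'cV[int]_2 := delta_mx 0 0.
  have : e = 0 by apply: qf_eq0; rewrite qfE c0 !mxE /=; ring.
  by move=> /(congr1 (fun v : 'cV_2 => v 0 0)); rewrite !mxE.
have qx x : qf (vx x) = A 1 0 * x ^+ 2 + (A 1 1 - A 0 0) * x - A 0 1.
  by rewrite qfE !mxE /=; ring.
(* A polynomial of degree two takes each value at most twice, so five arguments cannot share two
   values. *)
have := kP 0; have := kP 1; have := kP 2; have := kP 3; have := kP 4; rewrite !qx.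
move: (A 1 0) (A 1 1 - A 0 0) (A 0 1) (k true) (k false) c0 => a b c k1 k0; rewrite !expr2.
lia.
Qed.

End Hyperbolic.

(** * Semidirect products of the plane lattice by a cyclic group *)

Definition expgz (G : groupType) (x : G) (k : int) : G :=
  (match k with Posz n => x ^+ n | Negz n => (x ^+ n.+1)^-1 end)%g.

Section IntPower.
Variable G : groupType.
Implicit Types x y : G.

Lemma expgzS x k : expgz x (k + 1) = (expgz x k * x)%g.
Proof.
case: k => [n|[|n]]; first by rewrite -[1]/(1%:Z) -PoszD addn1 /= expgSr.
  by rewrite NegzE addNr /= expg1 mulVg.
rewrite [in LHS]NegzE intS opprD addrAC addNr add0r -NegzE /=.
by rewrite [in RHS]expgS invgM mulgVK.
Qed.

Lemma expgzP x k : expgz x (k - 1) = (expgz x k * x^-1)%g.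
Proof. by rewrite -[in RHS](subrK 1 k) expgzS mulgK. Qed.

Lemma expgzD x k l : expgz x (k + l) = (expgz x k * expgz x l)%g.
Proof.
elim/int_ind: l => [|n IH|n IH]; first by rewrite addr0 mulg1.
  by rewrite intS [1 + _]addrC addrA !expgzS IH mulgA.
by rewrite intS opprD [-1 + _]addrC addrA !expgzP IH mulgA.
Qed.

Lemma expgzN x k : expgz x (- k) = (expgz x k)^-1%g.
Proof. by apply: (@mulgI _ (expgz x k)); rewrite -expgzD subrr mulgV. Qed.

Lemma expgz1 x : expgz x 1 = x.
Proof. exact: expg1. Qed.

Lemma conj_expgz x y k : (expgz x k ^ y)%g = expgz (x ^ y)%g k.
Proof. by case: k => n /=; rewrite ?conjVg conjXg. Qed.

Lemma conjg_expgz x k : (x ^ expgz x k = x)%g.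
Proof. by rewrite conjgE -{2}[x]expgz1 -expgzD addrC expgzD expgz1 mulKg. Qed.

End IntPower.

Section SemiDirect.
Variables (G : groupType) (A : 'M[int]_2) (iota : 'cV[int]_2 -> G) (t : G).
Hypothesis unitA : A \is a GRing.unit.
Hypothesis iotaD : forall m n, iota (m + n) = (iota m * iota n)%g.
Hypothesis iota_inj : injective iota.
Hypothesis iotat : forall n, (iota n * t = t * iota (A *m n))%g.
Implicit Types (a b c : G) (m n v : 'cV[int]_2) (C D : 'M[int]_2) (k l : int).

(** Conjugation is a right action, so products in the group reverse as matrix products. *)
Definition acts c C := forall n, (iota n ^ c)%g = iota (C *m n).
(** The projection to the cyclic factor, as a relation: it has no value outside the semidirect
    product, and is single-valued once [A] has infinite order. *)
Definition deg a k := exists n, (a = iota n * expgz t k)%g.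
Definition semidirect a := exists n k, (a = iota n * expgz t k)%g.

Lemma semidirect_deg a : semidirect a <-> exists k, deg a k.
Proof. by split => [[n [k]]|[k [n]]] ->; [exists k, n|exists n, k]. Qed.

Lemma iota0 : iota 0 = 1%g.
Proof. by apply: (@mulgI _ (iota 0)); rewrite -iotaD addr0 mulg1. Qed.

Lemma iotaN n : iota (- n) = (iota n)^-1%g.
Proof. by apply: (@mulgI _ (iota n)); rewrite -iotaD subrr mulgV iota0. Qed.

Lemma actsM a b C D : acts a C -> acts b D -> acts (a * b)%g (D *m C).
Proof. by move=> aC bD n; rewrite conjgM aC bD mulmxA. Qed.

Lemma acts_uniq a C D : acts a C -> acts a D -> C = D.
Proof. by move=> aC aD; apply: mx2P => v; apply: iota_inj; rewrite -aC -aD. Qed.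

Lemma acts_iota m : acts (iota m) 1.
Proof.
by move=> n; rewrite -[1]/(1%:M : 'M_2) mul1mx conjgE -iotaD [n + m]addrC iotaD mulKg.
Qed.

Lemma acts_t : acts t A.
Proof. by move=> n; rewrite conjgE iotat mulKg. Qed.

Lemma acts_expgz k : acts (expgz t k) (A ^ k).
Proof.
elim/int_ind: k => [n|k IH|k IH]; first by rewrite expr0z mul1mx conjg1.
  rewrite intS addrC expgzS addrC exprzDr// expr1z.
  exact: (actsM IH acts_t).
rewrite intS opprD [-1 - _]addrC expgzP [- k%:Z + -1]addrC exprzDr//.
apply: (actsM IH) => n; apply: (can_inj (conjgK t)); rewrite -conjgM mulVg conjg1 acts_t mulmxA.
by rewrite -[A *m _]/(A * A^-1) divrr// mul1mx.
Qed.

Lemma iota_expgz n k : (iota n * expgz t k = expgz t k * iota (A ^ k *m n))%g.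
Proof. by rewrite -acts_expgz conjgE !mulgA mulgV mul1g. Qed.

Lemma expgz_iota n k : (expgz t k * iota n = iota (A ^ (- k) *m n) * expgz t k)%g.
Proof.
rewrite iota_expgz mulmxA -[A ^ k *m _]/(A ^ k * A ^ (- k)) -exprzDr// subrr expr0z.
by rewrite mul1mx.
Qed.

Lemma deg_iota n : deg (iota n) 0.
Proof. by exists n; rewrite mulg1. Qed.

Lemma deg_expgz k : deg (expgz t k) k.
Proof. by exists 0; rewrite iota0 mul1g. Qed.

Lemma deg_t : deg t 1.
Proof. by rewrite -[t in X in deg X]expgz1; exact: deg_expgz. Qed.

Lemma degM a b k l : deg a k -> deg b l -> deg (a * b)%g (k + l).
Proof.
move=> [m ->] [n ->]; exists (m + A ^ (- k) *m n).
by rewrite iotaD expgzD !mulgA -(mulgA (iota m) (expgz t k)) expgz_iota !mulgA.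
Qed.

Lemma degV a k : deg a k -> deg a^-1%g (- k).
Proof.
by move=> [m ->]; rewrite invgM -expgzN -iotaN expgz_iota; exists (A ^ (- - k) *m (- m)).
Qed.

Lemma deg_pow a k l : deg a k -> deg (expgz a l) (k * l).
Proof.
move=> ak; elim/int_ind: l => [|n IH|n IH].
- by rewrite mulr0; exact: (deg_expgz 0).
- by rewrite intS addrC expgzS mulrDr mulr1; exact: degM.
- by rewrite intS opprD addrC expgzP mulrDr mulrN1; apply: degM => //; exact: degV.
Qed.

Lemma deg_conj a b k l : deg a k -> deg b l -> deg (a ^ b)%g k.
Proof.
move=> ak bl; rewrite conjgE; have := degM (degV bl) (degM ak bl).
by have -> : - l + (k + l) = k by lia.
Qed.

Lemma acts_deg a k : deg a k -> acts a (A ^ k).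
Proof.
by move=> [m ->]; rewrite -[A ^ k]mulmx1; exact: (actsM (acts_iota m) (acts_expgz k)).
Qed.

Lemma deg0_iota a : deg a 0 -> exists n, a = iota n.
Proof. by move=> [n ->]; exists n; rewrite mulg1. Qed.

Lemma degP a k : deg a k -> exists n, (a = expgz t k * iota n)%g.
Proof. by move=> [n ->]; exists (A ^ k *m n); rewrite iota_expgz. Qed.

Hypothesis A_inf : forall k, A ^ k = 1 -> k = 0.

(** The difference of two degrees is a degree of the identity, which acts trivially and also by that
    power of [A]. *)
Lemma deg_uniq a k l : deg a k -> deg a l -> k = l.
Proof.
move=> ak al; have := degM ak (degV al); rewrite mulgV => /acts_deg a1.
have /A_inf := acts_uniq a1 (acts_deg (deg_expgz 0)); lia.
Qed.

End SemiDirect.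

(** * Pointwise inner automorphisms *)

Section PointwiseInner.
Variable G : groupType.
Implicit Types (phi : G -> G) (x y g : G).

Definition pointwise_inner phi :=
  (forall x y, phi (x * y)%g = (phi x * phi y)%g) /\ forall x, exists h, phi x = (x ^ h)%g.

Lemma pointwise_innerJ phi g : pointwise_inner phi ->
  pointwise_inner (fun x => (phi x ^ g)%g).
Proof.
move=> [phiM phiC]; split=> [x y|x]; first by rewrite phiM conjMg.
by have [h ->] := phiC x; exists (h * g)%g; rewrite conjgM.
Qed.

Lemma innerJ phi g : inner (fun x => (phi x ^ g)%g) -> inner phi.
Proof. by move=> [h hE]; exists (h * g^-1)%g => x; rewrite conjgM -hE -conjgM mulgV conjg1. Qed.

Lemma pointwise_inner_expgz phi x k : pointwise_inner phi ->
  phi (expgz x k) = expgz (phi x) k.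
Proof.
move=> [phiM _]; have phi1 : phi 1%g = 1%g by apply: (@mulgI _ (phi 1%g)); rewrite -phiM !mulg1.
elim/int_ind: k => [|n IH|n IH]; first exact: phi1.
  by rewrite intS addrC !expgzS phiM IH.
rewrite intS opprD addrC !expgzP phiM IH; congr (_ * _)%g.
by apply: (@mulgI _ (phi x)); rewrite -phiM !mulgV.
Qed.

(** As [phi t] is conjugate to [t], composing with a conjugation makes [phi] fix [t] and does not
    affect innerness. *)
Lemma inner_fixing t : (forall phi, pointwise_inner phi -> phi t = t -> inner phi) ->
  forall phi, pointwise_inner phi -> inner phi.
Proof.
move=> h phi pphi; have [g phig] := pphi.2 t.
apply: (@innerJ _ g^-1%g); apply: h; first exact: pointwise_innerJ.
by rewrite phig -conjgM mulgV conjg1.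
Qed.

Lemma property_AP : (forall phi, pointwise_inner phi -> inner phi) -> property_A G.
Proof.
move=> h phi _ cphi; apply: h; split; first by move=> x y; rewrite gmulfM.
move=> x; have : (phi @` conj_class x)%classic (phi x).
  by exists x => //; exists 1%g => //; rewrite conjg1.
by rewrite cphi => -[g _ <-]; exists g.
Qed.

End PointwiseInner.

(** * Pointwise inner maps of lattice extensions with irreducible action *)

Section Irreducible.
Variables (G : groupType) (A : 'M[int]_2) (iota : 'cV[int]_2 -> G) (t : G).
Hypothesis unitA : A \is a GRing.unit.
Hypothesis iotaD : forall m n, iota (m + n) = (iota m * iota n)%g.
Hypothesis iota_inj : injective iota.
Hypothesis iotat : forall n, (iota n * t = t * iota (A *m n))%g.
Hypothesis irrA : forall B C (v : 'cV[int]_2), A *m B = B *m A -> A *m C = C *m A ->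
  v != 0 -> B *m v = C *m v -> B = C.
Hypothesis iota_normal : forall c n, exists m, (iota n ^ c)%g = iota m.
Implicit Types (phi : G -> G) (a b c : G) (m n v : 'cV[int]_2).
Implicit Types (B C : 'M[int]_2) (k l : int).
Local Notation acts := (acts iota).
Local Notation semidirect := (semidirect iota t).

Lemma acts_exists c : exists C, acts c C.
Proof.
have [F FP] := choice (iota_normal c).
have [|C FC] := @additive_mx F; last by exists C => n; rewrite FP FC.
by move=> m n; apply: iota_inj; rewrite iotaD -!FP iotaD conjMg.
Qed.

Lemma pointwise_inner_mx phi : pointwise_inner phi ->
  exists B, forall n, phi (iota n) = iota (B *m n).
Proof.
move=> [phiM phiC]; have h n : exists m, phi (iota n) = iota m.
  by have [c ->] := phiC (iota n); exact: iota_normal.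
have [F FP] := choice h.
have [|B FB] := @additive_mx F; last by exists B => n; rewrite FP FB.
by move=> m n; apply: iota_inj; rewrite iotaD -!FP iotaD phiM.
Qed.

(** Apply [phi] to the relation [iotat]. *)
Lemma pointwise_inner_comm phi B : pointwise_inner phi -> phi t = t ->
  (forall n, phi (iota n) = iota (B *m n)) -> A *m B = B *m A.
Proof.
move=> [phiM _] phit phiB; apply: mx2P => v; apply: iota_inj.
apply: (@mulgI _ t); rewrite -!mulmxA -phiB -iotat.
by rewrite -{2}phit -phiM -iotat phiM phiB phit.
Qed.

(* If [phi] fixes [t] and agrees with a power of [t] at one nonzero vector, it
   does so on the whole plane by irreducibility. *)
Lemma pointwise_inner_power phi B k v : pointwise_inner phi -> phi t = t ->
  (forall n, phi (iota n) = iota (B *m n)) -> v != 0 -> B *m v = A ^ k *m v -> B = A ^ k.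
Proof.
move=> pphi phit phiB v0; apply: irrA v0; first exact: pointwise_inner_comm phiB.
by have /(commrXz k) : GRing.comm A A by [].
Qed.

Lemma semidirect_fixed phi a : pointwise_inner phi -> phi t = t ->
  (forall n, phi (iota n) = iota n) -> semidirect a -> phi a = a.
Proof.
move=> pphi phit phin [n [k ->]]; have [phiM _] := pphi.
by rewrite phiM phin pointwise_inner_expgz// phit.
Qed.

Lemma delta_neq0 : (delta_mx 0 0 : 'cV[int]_2) != 0.
Proof. by apply/negP => /eqP/(congr1 (fun v : 'cV_2 => v 0 0)); rewrite !mxE. Qed.

(** The conjugator of one nonzero translation has a degree [k], so [phi] acts on the lattice by
    [A ^ k]; undoing this by a power of [t] fixes all generators. The section assumes irreducibility
    in place of a trace condition, so that a square root of the hyperbolic element can take the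
    place of [t]. *)
Lemma semidirect_inner phi : (forall a, semidirect a) -> pointwise_inner phi -> inner phi.
Proof.
move=> all_sd; apply: (@inner_fixing _ t) => {}phi pphi phit.
have [B phiB] := pointwise_inner_mx pphi.
have [h hE] := pphi.2 (iota (delta_mx 0 0)).
have [k hk] : exists k, deg iota t h k by apply/semidirect_deg.
have BA : B = A ^ k.
  apply: (pointwise_inner_power pphi phit phiB delta_neq0); apply: iota_inj.
  by rewrite -phiB hE (acts_deg unitA iotaD iotat hk).
apply: (@innerJ _ _ (expgz t (- k))); exists 1%g => a; rewrite conjg1.
apply: (@semidirect_fixed (fun x => (phi x ^ expgz t (- k))%g)) (all_sd a).
- exact: pointwise_innerJ.
- by rewrite /= phit conjg_expgz.
- move=> n; rewrite phiB BA -(acts_expgz unitA iotat) -conjgM -expgzD subrr.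
  exact: conjg1.
Qed.

End Irreducible.

(** * Groups with a hyperbolic semidirect product of index at most two *)

Local Ltac vec_lra h :=
  move: (congr1 (fun w : 'cV[int]_2 => w 0 0) h)
    (congr1 (fun w : 'cV[int]_2 => w 1 0) h) => /=;
  rewrite ?mxE => ? ?; apply: cV2P; rewrite ?mxE; lra.

Section Sol.
Variables (G : groupType) (A : 'M[int]_2) (iota : 'cV[int]_2 -> G) (t : G).
Hypotheses (detA : \det A = 1) (trA : 2 < `|\tr A|).
Hypothesis iotaD : forall m n, iota (m + n) = (iota m * iota n)%g.
Hypothesis iota_inj : injective iota.
Hypothesis iotat : forall n, (iota n * t = t * iota (A *m n))%g.
Hypothesis index2 : forall a b, ~ semidirect iota t a -> ~ semidirect iota t b ->
  semidirect iota t (a * b^-1)%g.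
Implicit Types (phi : G -> G) (a b c : G) (m n v : 'cV[int]_2).
Implicit Types (B C : 'M[int]_2) (k l : int).
Local Notation acts := (acts iota).
Local Notation tdeg := (deg iota t).
Local Notation tsemidirect := (semidirect iota t).

Let uA : A \is a GRing.unit := unitA detA.
Let irrA B C v : A *m B = B *m A -> A *m C = C *m A -> v != 0 -> B *m v = C *m v -> B = C.
Proof. exact: comm_eq. Qed.
Let infA k : A ^ k = 1 -> k = 0. Proof. exact: expz_eq1. Qed.
Let dM a b k l : tdeg a k -> tdeg b l -> tdeg (a * b)%g (k + l).
Proof. exact: (degM uA iotaD iotat). Qed.
Let dV a k : tdeg a k -> tdeg a^-1%g (- k).
Proof. exact: (degV uA iotaD iotat). Qed.
Let dJ a b k l : tdeg a k -> tdeg b l -> tdeg (a ^ b)%g k.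
Proof. exact: (deg_conj uA iotaD iotat). Qed.
Let dX a k l : tdeg a k -> tdeg (expgz a l) (k * l).
Proof. exact: (deg_pow uA iotaD iotat). Qed.
Let dt : tdeg t 1. Proof. exact: deg_t iotaD. Qed.
Let di n : tdeg (iota n) 0. Proof. exact: deg_iota. Qed.
Let dU a k l : tdeg a k -> tdeg a l -> k = l.
Proof. exact: (deg_uniq uA iotaD iota_inj iotat infA). Qed.
Let ad a k : tdeg a k -> acts a (A ^ k).
Proof. exact: (acts_deg uA iotaD iotat). Qed.

Lemma semidirectM a b : tsemidirect a -> tsemidirect b -> tsemidirect (a * b)%g.
Proof.
move=> /semidirect_deg [k ak] /semidirect_deg [l bl].
by apply/semidirect_deg; exists (k + l); exact: dM.
Qed.

Lemma semidirectV a : tsemidirect a -> tsemidirect a^-1%g.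
Proof. by move=> /semidirect_deg [k ak]; apply/semidirect_deg; exists (- k); exact: dV. Qed.

(** A subgroup of index at most two is normal: were [c] and [a ^ c] both outside, [index2] would put
    [c^-1 * a], hence [c], inside. *)
Lemma semidirect_conj a c : tsemidirect a -> tsemidirect (a ^ c)%g.
Proof.
move=> sa; have [sc|nc] := pselect (tsemidirect c).
  by rewrite conjgE; apply: semidirectM; [exact: semidirectV|exact: semidirectM].
have [//|na] := pselect (tsemidirect (a ^ c)%g); case: (nc).
have h : tsemidirect (c^-1 * a)%g.
  by have := index2 na nc; rewrite conjgE mulgA mulgK.
by rewrite -(mulVKg a c) -[(a^-1 * c)%g]invgK invgM invgK; apply/semidirectM/semidirectV.
Qed.

Lemma trace_neq2 : 2 - \tr A != 0.
Proof. by apply/negP => /eqP h; move: trA; rewrite (_ : \tr A = 2) ?normr_nat//; lia. Qed.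

Lemma det_sub1 : \det (A - 1) = 2 - \tr A.
Proof. by have := detA; rewrite !det2 tr2 !mxE /=; lia. Qed.

Lemma det_add1 : \det (A + 1) = 2 + \tr A.
Proof. by have := detA; rewrite !det2 tr2 !mxE /=; lia. Qed.

Lemma iotaX n (p : nat) : iota (n *+ p) = (iota n ^+ p)%g.
Proof.
elim: p => [|p IH]; first exact: iota0.
by rewrite mulrS iotaD IH expgS.
Qed.

(* The commutators [(iota v)^t (iota v)^-1] are exactly the translations by
   [(A - 1) v], and every translation has a nonzero multiple of this form. *)
Lemma iota_normal c n : exists m, (iota n ^ c)%g = iota m.
Proof.
have sdt (a : G) : tsemidirect a -> exists k, tdeg (a ^ c)%g k.
  by move=> /(@semidirect_conj _ c)/semidirect_deg.
have sdi v : tsemidirect (iota v) by apply/semidirect_deg; exists 0; exact: di.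
have st : tsemidirect t by apply/semidirect_deg; exists 1; exact: dt.
(* A translation by [(A - 1) *m v] is a commutator, hence so is its conjugate by [c], and
   commutators in the semidirect product have degree 0. *)
have comm v : tdeg (iota ((A - 1) *m v) ^ c)%g 0.
  have [k vk] := sdt _ (sdi v); have [l tl] := sdt _ st.
  rewrite mulmxBl mul1mx iotaD iotaN// -(acts_t iotat) conjMg conjVg conjJg.
  rewrite -(subrr k); apply: dM; last exact: dV.
  exact: dJ tl.
have [k nk] := sdt _ (sdi n).
(* [p] is the absolute value of [\det (A - 1)], and the adjugate supplies [v]. *)
have [p [p0 [v pv]]] : exists p : nat, p != 0 /\ exists v, n *+ p = (A - 1) *m v.
  exists (absz (2 - \tr A)); split; first by rewrite absz_eq0 trace_neq2.
  have e : (2 - \tr A) *: n = (A - 1) *m (\adj (A - 1) *m n).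
    by rewrite mulmxA mul_mx_adj det_sub1 mul_scalar_mx.
  have [h|h] : (absz (2 - \tr A))%:Z = 2 - \tr A \/
      (absz (2 - \tr A))%:Z = - (2 - \tr A) by lia.
    by exists (\adj (A - 1) *m n); rewrite -e -scaler_nat natz h.
  by exists (- (\adj (A - 1) *m n)); rewrite mulmxN -e -scaleNr -scaler_nat natz h.
have := dX (p : int) nk.
rewrite /= -conjXg -iotaX pv => h.
have kp0 := dU h (comm v).
have k0 : k = 0.
  by move/eqP: kp0; rewrite mulf_eq0 => /orP[/eqP //|/eqP [] p00]; rewrite p00 in p0.
by rewrite k0 in nk; exact: deg0_iota nk.
Qed.

(** Conjugations by [c] and [c^-1] multiply degrees by integers [k] and [l] with [l * k = 1]. The
    matrix identity compares the actions of [t * c] and [c * t ^ c]. *)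
Lemma deg_conj_t c C : acts c C -> exists k,
  [/\ tdeg (t ^ c)%g k, k = 1 \/ k = -1 & C *m A = A ^ k *m C].
Proof.
move=> cC; have st : tsemidirect t by apply/semidirect_deg; exists 1; exact: dt.
have /semidirect_deg [k tk] := semidirect_conj c st.
have /semidirect_deg [l tl] := semidirect_conj c^-1%g st.
exists k; split => //.
  have [n tn] := tk.
  have [m nm] := iota_normal c^-1%g n.
  have : tdeg ((t ^ c) ^ c^-1)%g (0 + l * k).
    by rewrite tn conjMg nm conj_expgz; apply: dM; [exact: di|exact: dX].
  rewrite -conjgM mulgV conjg1 add0r => /(dU dt) lk.
  have : (k %| 1)%Z by apply/dvdzP; exists l.
  by rewrite dvdz1; lia.
apply: (acts_uniq iota_inj (a := (t * c)%g)).
  exact: (actsM (acts_t iotat) cC).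
by rewrite conjgC; exact: (actsM cC (ad tk)).
Qed.

Lemma semidirect_coset a c : ~ tsemidirect c -> ~ tsemidirect a ->
  exists s k, tdeg s k /\ a = (s * c)%g.
Proof.
move=> nc na; have /semidirect_deg [k ak] := index2 na nc.
by exists (a * c^-1)%g, k; rewrite mulgVK.
Qed.

(* An automorphism that is the identity on the index two subgroup moves
   another element [c] by a factor centralizing that subgroup; the factor is
   in the subgroup, hence trivial. *)
Lemma fixed_everywhere phi : pointwise_inner phi -> phi t = t ->
  (forall n, phi (iota n) = iota n) -> forall c, phi c = c.
Proof.
move=> pphi phit phin.
have fixS a : tsemidirect a -> phi a = a by exact: semidirect_fixed.
move=> c; have [|nc] := pselect (tsemidirect c); first exact: fixS.
have [phiM phiC] := pphi.
have phiJ a : phi (a ^ c)%g = (phi a ^ phi c)%g.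
  apply: (@mulgI _ (phi c)); rewrite -phiM -!conjgC phiM; congr (_ * _)%g.
have cen a : tsemidirect a -> (a ^ (phi c * c^-1) = a)%g.
  move=> sa; rewrite conjgM -{1}(fixS a sa) -phiJ fixS; last exact: semidirect_conj.
  by rewrite -conjgM mulgV conjg1.
have [g phic] := phiC c.
have nphic : ~ tsemidirect (phi c).
  move=> h; apply: nc; rewrite -(conjgK g c) -phic; exact: semidirect_conj.
have /semidirect_deg [k zk] := index2 nphic nc.
have k0 : k = 0.
  apply: infA; apply: (acts_uniq iota_inj (ad zk)) => n.
  by rewrite cen ?mul1mx//; apply/semidirect_deg; exists 0; exact: di.
rewrite k0 in zk; have [m zm] := deg0_iota zk.
have m0 : m = 0.
  (* The translation [iota m] commutes with [t], so [A] fixes [m]; a nonzero [m] would force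
     [A = 1], against the trace. *)
  have Am : A *m m = 1 *m m.
    apply: iota_inj; rewrite mul1mx -(acts_t iotat) -zm.
    have := cen t; rewrite zm conjgE => tm.
    apply: (@mulgI _ t); rewrite -conjgC.
    rewrite -[in LHS]tm ?mulVKg//.
    by apply/semidirect_deg; exists 1; exact: dt.
  apply/eqP; apply: contraT => m0; have A1 : A = 1.
    by apply: irrA m0 Am => //; rewrite mulmx1 mul1mx.
  by have := trA; rewrite A1 mxtrace1.
by apply: divg1_eq; rewrite zm m0 iota0.
Qed.

Lemma inner_of_conj phi g C : pointwise_inner phi -> acts g C ->
  phi t = (t ^ g)%g -> (forall n, phi (iota n) = iota (C *m n)) -> inner phi.
Proof.
move=> pphi gC phit phin; apply: (@innerJ _ _ g^-1%g); exists 1%g => a; rewrite conjg1.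
apply: (@fixed_everywhere (fun x => (phi x ^ g^-1)%g)).
- exact: pointwise_innerJ.
- by rewrite /= phit conjgK.
- by move=> n /=; rewrite phin -gC conjgK.
Qed.

Lemma acts_unit c C : acts c C -> C \is a GRing.unit.
Proof.
move=> cC; have [D cD] := acts_exists iotaD iota_inj iota_normal c^-1%g.
have := actsM cC cD; rewrite mulgV => h.
have DC : D *m C = 1%:M.
  by apply: (acts_uniq iota_inj h) => n; rewrite conjg1 mul1mx.
by have [_] := mulmx1_unit DC.
Qed.

(* Up to a translation, [c * expgz t (- i)] is a square root of [t]; together with
   the translations it generates [G]. *)
Lemma square_root_inner c C i : ~ tsemidirect c -> acts c C -> tdeg (t ^ c)%g 1 ->
  tdeg (c * c)%g (i + i + 1) -> forall phi, pointwise_inner phi -> inner phi.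
Proof.
move=> nc cC tc cc; pose s := (c * expgz t (- i))%g; pose S := A ^ (- i) *m C.
have sS : acts s S by apply: (actsM cC); exact: ad (deg_expgz t iotaD _).
move: S sS => S sS.
have ti : tdeg (expgz t (- i)) (- i) by exact: deg_expgz.
(* [c * c] contributes [i + i + 1], and each of the two factors [expgz t (- i)] contributes [- i],
   as [t ^ c] has degree 1. *)
have ss : tdeg (s * s)%g 1.
  have -> : (s * s = c * c * (expgz t (- i) ^ c) * expgz t (- i))%g.
    by rewrite /s conjgE !mulgA mulgK.
  have := dM (dM cc (dX (- i) tc)) ti; rewrite -conj_expgz.
  by have -> : i + i + 1 + 1 * - i + - i = 1 by lia.
have SA : S *m S = A by apply: (acts_uniq iota_inj (actsM sS sS)); exact: ad ss.
have uS := acts_unit sS.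
have ns : ~ tsemidirect s.
  move=> sds; apply: nc; rewrite -(mulgK (expgz t (- i)) c); apply: semidirectM => //.
  by apply: semidirectV; apply/semidirect_deg; exists (- i).
have iotas n : (iota n * s = s * iota (S *m n))%g by rewrite -sS conjgC.
(* What commutes with [S] commutes with its square [A], so [S] inherits irreducibility. *)
have comS B : S *m B = B *m S -> A *m B = B *m A.
  move=> SB; rewrite -SA; transitivity (S *m B *m S).
    by rewrite -(mulmxA S S B) [in LHS]SB mulmxA.
  by rewrite SB (mulmxA B S S).
(* Up to a translation [t] is [s * s], so the semidirect product built on [s] contains the one built
   on [t]. *)
have ts2 : deg iota s t 2.
  have [m ssm] := ss; exists (- m).
  by rewrite iotaN// -[expgz s 2]/(s * s)%g ssm expgz1 mulKg.
have sd a : tsemidirect a -> semidirect iota s a.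
  move=> [n [k ->]]; apply/semidirect_deg; exists (0 + 2 * k).
  apply: (degM uS iotaD iotas); first exact: deg_iota.
  exact: (deg_pow uS iotaD iotas).
move=> phi pphi; apply: (semidirect_inner uS iotaD iota_inj iotas _ iota_normal _ pphi).
  by move=> B D v /comS AB /comS AD; exact: (irrA AB AD).
move=> a; have [/sd //|na] := pselect (tsemidirect a).
have /sd/semidirect_deg [k hk] := index2 na ns.
apply/semidirect_deg; exists (k + 1); rewrite -(mulgVK s a).
by apply: (degM uS iotaD iotas) => //; exact: deg_t.
Qed.

Lemma add1_inj (u : 'cV[int]_2) : (A + 1) *m u = 0 -> u = 0.
Proof.
move=> Au; apply/eqP; apply: contraT => u0.
have A1 : A = -1.
  apply: (irrA _ _ u0) => //; first by rewrite mulmxN mulNmx mulmx1 mul1mx.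
  by apply/eqP; rewrite -subr_eq0 -mulmxBl opprK Au.
by have := trA; rewrite A1 raddfN /= mxtrace1 normrN.
Qed.

(** Exponents matter only modulo [p], up to the image of [A ^ p - 1]; this is the same ambiguity as
    in [conj_screw]. *)
Lemma expz_mod (p k r : int) v :
  exists y, A ^ (p * k + r) *m v = A ^ r *m v + (A ^ p - 1) *m y.
Proof.
have [|C CE] := @expz_sub1 (A ^ p) k; first by rewrite unitrXz.
exists (C *m (A ^ r *m v)); rewrite mulmxA -CE exprzDr// -exprz_exp mulmxBl mul1mx.
by rewrite -[_ * _]/(_ *m _) mulmxA addrC subrK.
Qed.

(** Conjugating by a translation changes [v] by an element of the image of [A ^ p - 1]; conjugating
    by a power of [t] applies that power of [A]. *)
Lemma conj_screw (p : int) s k v : tdeg s k ->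
  exists y, ((expgz t p * iota v) ^ s = expgz t p * iota (A ^ k *m v + (A ^ p - 1) *m y))%g.
Proof.
move=> [m ->]; exists (- (A ^ k *m m)); rewrite conjgM.
have -> : ((expgz t p * iota v) ^ iota m = expgz t p * iota (v + m - A ^ p *m m))%g.
  rewrite conjgE -iotaN// -mulgA -iotaD mulgA (iota_expgz uA iotat) -mulgA -iotaD.
  by rewrite mulmxN addrC.
rewrite conjMg (acts_expgz uA iotat); congr (_ * iota _)%g.
  by rewrite conjgE -!expgzN -!expgzD; congr expgz; lia.
rewrite mulmxBr mulmxDr mulmxN mulmxBl mul1mx opprB -addrA; congr (_ + (_ - _)).
by rewrite !mulmxA -[LHS]/(_ * _ *m _) -[A ^ p *m _]/(_ * _) -!exprzDr// addrC.
Qed.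

(* Write [t ^ c] as [t * iota n0]. If [n0] is not in the image of [A - 1], comparing
   the conjugates of [t * iota v] and [t * t * iota v] with their images under [phi]
   shows that [A - 1] and [A + 1] both divide [2], which their determinants forbid. *)
Lemma minus_inner c phi : ~ tsemidirect c -> acts c (-1) -> tdeg (t ^ c)%g 1 ->
  pointwise_inner phi -> phi t = t -> (forall n, phi (iota n) = iota (- n)) -> inner phi.
Proof.
move=> nc cN tc pphi phit phiN; have [phiM phiC] := pphi.
have [n0 tn0] := degP uA iotat tc; rewrite expgz1 in tn0.
have [[x n0x]|n0N] := pselect (exists x, n0 = (A - 1) *m x).
  (* The translation by [x] corrects [c] so that it centralizes [t], and leaves its action on the
     lattice unchanged. *)
  apply: (@inner_of_conj _ (c * iota x)%g (-1)) => //.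
  - rewrite -[-1]mul1mx; apply: (actsM cN); exact: acts_iota.
  - rewrite phit conjgM tn0 conjMg acts_iota// conjgE mulgA -iotaN// iotat -!mulgA -!iotaD.
    have -> : A *m - x + (x + 1 *m n0) = 0.
      by rewrite n0x mul1mx mulmxBl mul1mx mulmxN [x + _]addrC subrK addNr.
    by rewrite iota0// mulg1.
  - by move=> n; rewrite phiN mulNmx mul1mx.
exfalso.
have conj_c w : (iota w ^ c)%g = iota (- w) by rewrite cN mulNmx mul1mx.
(* The image of [expgz t p * iota v] is computed from the values of [phi] and from a conjugator,
   which lies in the subgroup or in the coset of [c]. *)
have step (p : int) v : exists k y w, w = A ^ k *m v + (A ^ p - 1) *m y /\
    (iota (- v) = iota w \/
     (expgz t p * iota (- v))%g = (expgz (t * iota n0)%g p * iota (- w))%g).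
  have [h hE] := phiC (expgz t p * iota v)%g.
  rewrite phiM phiN pointwise_inner_expgz// phit in hE.
  have [/semidirect_deg [k hk]|nh] := pselect (tsemidirect h).
    have [y hy] := conj_screw p v hk; exists k, y; eexists; split; first by []; left.
    by apply: (@mulgI _ (expgz t p)); rewrite hE hy.
  have [s [k [sk hs]]] := semidirect_coset nc nh.
  have [y sy] := conj_screw p v sk; exists k, y; eexists; split; first by []; right.
  by rewrite hE hs conjgM sy conjMg conj_expgz tn0 conj_c.
(* For [p = 1], powers of [A] are trivial modulo the image of [A - 1]; a conjugator in the coset of
   [c] would put [n0] in that image. *)
have twice_sub v : exists z, v + v = (A - 1) *m z.
  have [k [y [w [->]]]] := step 1 v; have [y' ky'] := expz_mod 1 k 0 v.
  rewrite mul1r addr0 expr0z mul1mx expr1z in ky'.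
  rewrite ky' expr1z !expgz1 -addrA -mulmxDr => -[/iota_inj|].
    move=> h; exists (- (y' + y)); rewrite mulmxN; move: h; move: (_ *m _) => q h; vec_lra h.
  rewrite -mulgA -iotaD => /mulgI/iota_inj h; case: n0N; exists (y' + y).
  by move: h; move: (_ *m _) => q h; vec_lra h.
have n0_add v : (exists z, v = (A - 1) *m z) \/ (exists z, v + v = (A + 1) *m z).
  have [k [y [w [->]]]] := step 2 v.
  have [q [r kE]] : exists (q : int) (r : bool), k = 2 * q + (r : int).
    by exists (k %/ 2)%Z, ((k %% 2)%Z == 1); lia.
  have [y' ky'] := expz_mod 2 q r v.
  have A2 : A ^ 2 - 1 = (A + 1) *m (A - 1).
    by rewrite -[_ *m _]/(_ * _) mulrDl mul1r mulrBr mulr1 addrA subrK.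
  rewrite kE ky' -addrA -mulmxDr A2 -mulmxA.
  move: (y' + y) => {}y; set u := (A - 1) *m y.
  have e2 : (expgz (t * iota n0) 2 = expgz t 2 * iota ((A + 1) *m n0))%g.
    rewrite -[expgz _ 2]/(t * iota n0 * (t * iota n0))%g -[expgz t 2]/(t * t)%g.
    by rewrite mulmxDl mul1mx iotaD -!mulgA; congr (_ * _)%g; rewrite !mulgA iotat.
  (* Four cases: conjugator in the subgroup or in the coset, and in each [r] equal to 1 or 0. In the
     first and the last the equation is [A + 1] applied to a vector, which therefore vanishes; the
     last contradicts the choice of [n0]. *)
  rewrite e2 -(mulgA (expgz t 2) (iota _)) -iotaD =>
    -[/iota_inj|/mulgI/iota_inj]; case: r {kE ky'} => /=; rewrite ?expr1z ?expr0z ?mul1mx => h.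
  - left; exists (- y); rewrite mulmxN -/u.
    suff /add1_inj h' : (A + 1) *m (v + u) = 0 by vec_lra h'.
    rewrite mulmxDr [(A + 1) *m v]mulmxDl mul1mx; move: h.
    by move: (A *m v) (_ *m u) => a b h; vec_lra h.
  - by right; exists (- u); rewrite mulmxN; move: h; move: (_ *m u) => b h; vec_lra h.
  - right; exists (v - n0 + u); rewrite mulmxDr mulmxBr [(A + 1) *m v]mulmxDl mul1mx.
    move: h; move: (_ *m n0) (_ *m u) (A *m v) => a b d h; vec_lra h.
  - case: n0N; exists y; rewrite -/u.
    suff /add1_inj h' : (A + 1) *m (n0 - u) = 0 by vec_lra h'.
    by rewrite mulmxBr; move: h; move: (_ *m n0) (_ *m u) => a b h; vec_lra h.
(* If [v] is in the image of [A - 1], then [n0] and [v + n0] are not; their doubles are thus in the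
   image of [A + 1], and so is [v + v]. *)
have twice_add v : exists z, v + v = (A + 1) *m z.
  have [[z0 z0E]|[z1 n0E]] := n0_add n0; first by case: n0N; exists z0.
  have [[z zE]|//] := n0_add v.
  have [[z2 z2E]|[z2 z2E]] := n0_add (v + n0).
    by case: n0N; exists (z2 - z); rewrite mulmxBr -z2E -zE addrAC subrr add0r.
  by exists (z2 - z1); rewrite mulmxBr -z2E -n0E; apply: cV2P; rewrite !mxE; lia.
(* Both [2 - \tr A] and [2 + \tr A] divide 4, but one of them is at least 5. *)
have [k1] := det_double twice_sub; have [k2] := det_double twice_add.
rewrite det_sub1 det_add1; move: trA; move: (\tr A) => T T2 h2 h1.
have [T3|T3] : 3 <= T \/ T <= -3 by lia.
  by have [k2p|k2n] := lerP 1 k2; nia.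
by have [k1p|k1n] := lerP 1 k1; nia.
Qed.

Theorem sol_property_A : property_A G.
Proof.
apply: property_AP; apply: (@inner_fixing _ t) => phi pphi phit.
have [phiM phiC] := pphi.
have [B phiB] := pointwise_inner_mx iotaD iota_inj iota_normal pphi.
have AB := pointwise_inner_comm iota_inj iotat pphi phit phiB.
have [[k [v [v0 Bv]]]|noI] := pselect (exists (k : int) v, v != 0 /\ B *m v = A ^ k *m v).
  have BA := pointwise_inner_power iota_inj iotat irrA pphi phit phiB v0 Bv.
  apply: (inner_of_conj pphi (acts_expgz uA iotat k)) => [|n]; last by rewrite phiB BA.
  by rewrite phit conjg_expgz.
(* A conjugator inside the subgroup would make [B] agree with a power of [A] at [v]. *)
have conj v : v != 0 -> exists2 h, ~ tsemidirect h & forall C, acts h C -> B *m v = C *m v.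
  move=> v0; have [h hE] := phiC (iota v); exists h.
    move=> /semidirect_deg [k hk]; apply: noI; exists k, v; split => //.
    by apply: iota_inj; rewrite -phiB hE (ad hk).
  by move=> C hC; apply: iota_inj; rewrite -phiB hE hC.
have [c nc cB] := conj _ delta_neq0.
have [C cC] := acts_exists iotaD iota_inj iota_normal c.
have [k [tk k1 CA]] := deg_conj_t cC.
case: k1 => k1; rewrite k1 in tk CA; last first.
  exfalso; apply: (no_pointwise_reflection detA trA AB (acts_unit cC) CA) => v v0.
  have [h nh hB] := conj v v0.
  have [s [l [sl hE]]] := semidirect_coset nc nh.
  by exists l; rewrite mulmxA; apply: hB; rewrite hE; apply: actsM => //; exact: ad.
rewrite expr1z in CA.
have BC : B = C by apply: (irrA AB (esym CA) delta_neq0); exact: cB.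
have nVc : ~ tsemidirect c^-1%g by move=> /semidirectV; rewrite invgK.
have /semidirect_deg [j cj] := index2 nc nVc; rewrite invgK in cj.
(* An odd degree of [c * c] leads to a square root of [t], an even one to [S *m S = 1]. *)
have [i [r jE]] : exists (i : int) (r : bool), j = i + i + (r : int).
  by exists (j %/ 2)%Z, ((j %% 2)%Z == 1); lia.
case: r jE => /= jE; rewrite {}jE in cj; first exact: (square_root_inner nc cC tk cj pphi).
rewrite addr0 in cj.
pose s := (c * expgz t (- i))%g; pose S := A ^ (- i) *m C.
have ti : tdeg (expgz t (- i)) (- i) by exact: deg_expgz.
have sS : acts s S by apply: (actsM cC); exact: ad.
have ss : tdeg (s * s)%g 0.
  have -> : (s * s = c * c * (expgz t (- i) ^ c) * expgz t (- i))%g.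
    by rewrite /s conjgE !mulgA mulgK.
  have := dM (dM cj (dX (- i) tk)) ti; rewrite -conj_expgz.
  by have -> : i + i + 1 * - i + - i = 0 by lia.
have SS : S *m S = 1%:M.
  by apply: (acts_uniq iota_inj (actsM sS sS)) => n; rewrite (ad ss).
have AS : A *m S = S *m A.
  rewrite /S mulmxA -(comm_expz (- i) (B := A))//.
  by rewrite -mulmxA CA mulmxA.
have ns : ~ tsemidirect s.
  move=> sds; apply: nc; rewrite -(mulgK (expgz t (- i)) c); apply: semidirectM => //.
  by apply: semidirectV; apply/semidirect_deg; exists (- i).
(* [S] is not 1, since [B] would then be [A ^ i]; so some [S *m v - v] is nonzero, and [S] negates
   it. *)
have SN : S = -1.
  have [v Sv] : exists v, S *m v - v != 0.
    apply: contrapT => h; apply: noI; exists i, (delta_mx 0 0); split; first exact: delta_neq0.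
    rewrite BC; congr (_ *m _); have S1 : S = 1%:M.
      apply: mx2P => v; rewrite mul1mx; apply/eqP; rewrite -subr_eq0; apply: contraT => Sv.
      by case: h; exists v.
    rewrite -[RHS]mulmx1 -S1 /S mulmxA -[A ^ i *m _]/(A ^ i * A ^ (- i)) -exprzDr// subrr.
    by rewrite expr0z mul1mx.
  apply: (irrA AS _ Sv); first by rewrite mulmxN mulNmx mulmx1 mul1mx.
  by rewrite mulmxBr mulmxA SS mul1mx mulNmx mul1mx opprB.
apply: (@innerJ _ _ (expgz t (- i))); apply: (minus_inner ns).
- by rewrite -SN.
- rewrite conjgM; exact: dJ tk ti.
- exact: pointwise_innerJ.
- by rewrite /= phit conjg_expgz.
- move=> n /=; rewrite phiB BC (acts_expgz uA iotat) mulmxA -/S SN mulNmx mul1mx //.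
Qed.

End Sol.

Local Open Scope classical_set_scope.

(** * Unique lifting for coverings *)

Section Clamp.
Variable R : realType.

Definition clamp (a b r : R) : R := Num.max a (Num.min b r).

Lemma clamp_itv a b r : a <= b -> a <= clamp a b r <= b.
Proof. by move=> ab; rewrite /clamp le_max ge_max ge_min !lexx ab. Qed.

Lemma clamp_id a b r : a <= r <= b -> clamp a b r = r.
Proof. by move=> /andP[ar rb]; rewrite /clamp (min_idPr rb) (max_idPr ar). Qed.

Lemma clamp_continuous a b : continuous (clamp a b).
Proof.
move=> t; apply: continuous_max; first exact: cvg_cst.
by apply: continuous_min; [exact: cvg_cst|exact: cvg_id].
Qed.

Lemma clamp_left a m b r : a <= m -> m <= b -> r <= m ->
  clamp a m r = clamp a b r.
Proof.
move=> am mb rm; rewrite /clamp (min_idPr rm) (min_idPr _)//.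
exact: le_trans mb.
Qed.

Lemma clamp_right a m b r : a <= m -> m <= b -> m <= r ->
  clamp m b r = clamp a b r.
Proof.
move=> am mb mr; have mbr : m <= Num.min b r by rewrite le_min mb.
by rewrite /clamp (max_idPr mbr) (max_idPr _)// (le_trans am).
Qed.

End Clamp.

Section Covering.
Variables (R : realType) (E B : topologicalType) (p : E -> B).

Definition local_section (U : set B) (e : E) (s : B -> E) :=
  [/\ forall u, U u -> {for u, continuous s}, s (p e) = e,
      forall u, U u -> p (s u) = u & open (s @` U)].

(** Sections over a neighbourhood common to the whole fibre give existence of lifts; their open
    images and the separation of points of a fibre give uniqueness. *)
Definition covering_map :=
  [/\ continuous p,
      forall b, exists U : set B, [/\ open U, U b &
        forall e, U (p e) -> exists s, local_section U e s]
    & forall e e', p e = p e' -> e <> e' -> exists V V' : set E,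
        [/\ open V, open V', V e, V' e' & V `&` V' = set0]].

(* Lifts are only required along the unit square and the unit segment, which
   makes the property stable under composition. *)
Definition lifting :=
  [/\ continuous p,
      forall (K : R * R -> B) e, continuous K -> p e = K (0, 0) ->
        exists L : R * R -> E, [/\ continuous L, L (0, 0) = e &
          forall s t, 0 <= s <= 1 -> 0 <= t <= 1 -> p (L (s, t)) = K (s, t)]
    & forall g g' : R -> E, continuous g -> continuous g' -> g 0 = g' 0 ->
        (forall t, 0 <= t <= 1 -> p (g t) = p (g' t)) ->
        forall t, 0 <= t <= 1 -> g t = g' t].

Hypothesis covp : covering_map.

(** The agreement set is open, since [p] is injective on the open image of a section, and closed,
    since points of a fibre are separated; the line is connected. *)
Lemma covering_unique (g g' : R -> E) (a : R) :
  continuous g -> continuous g' -> (forall t, p (g t) = p (g' t)) ->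
  g a = g' a -> forall t, g t = g' t.
Proof.
have [_ secp sepp] := covp => cg cg' pg ga t.
pose A := [set t | g t = g' t].
suff : A = setT by move=> AT; have : A t by rewrite AT.
have conn : connected [set: R].
  by apply/connected_intervalP => x y _ _ z _.
have oA : open A.
  rewrite openE => r /= gr; rewrite /A /interior.
  have [U [oU Ub /(_ (g r) Ub) [s [cs sg ps os]]]] := secp (p (g r)).
  have near_s (h : R -> E) : continuous h -> h r = g r ->
      \forall u \near r, (s @` U) (h u).
    move=> ch hr; apply: (ch r); apply: open_nbhs_nbhs; split => //.
    by exists (p (g r)); rewrite // hr.
  have := near_s _ cg erefl; have := near_s _ cg' (esym gr).
  apply: filterS2 => u [b Ub' sb] [b' Ub'' sb'].
  rewrite /A /= -sb -sb'; congr s.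
  by rewrite -(ps b) // -(ps b')// sb sb' pg.
have cA : open (~` A).
  rewrite openE => r /= gr; rewrite /interior.
  have [V [V' [oV oV' Vg Vg' VV']]] := sepp _ _ (pg r) gr.
  have gV : \forall u \near r, V (g u) by apply: (cg r); exact: open_nbhs_nbhs.
  have gV' : \forall u \near r, V' (g' u) by apply: (cg' r); exact: open_nbhs_nbhs.
  apply: filterS2 gV gV' => u Vu V'u /= gu.
  by rewrite -[False]/(set0 (g u)) -VV'; split => //; rewrite gu.
apply: conn; [by exists a|by exists A; rewrite ?setTI|].
exists A; last by rewrite setTI.
by rewrite -(setCK A); exact: open_closedC.
Qed.

(** Clamping extends [K] from the rectangle to the plane, so that lifts are total functions and can
    be glued along full lines. *)
Definition liftable_on (K : R * R -> B) (a b c d : R) :=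
  forall e, p e = K (a, c) -> exists L : R * R -> E,
    [/\ continuous L, L (a, c) = e
      & forall z, p (L z) = K (clamp a b z.1, clamp c d z.2)].

Lemma liftable_swap K a b c d : liftable_on K a b c d ->
  liftable_on (fun z => K (z.2, z.1)) c d a b.
Proof.
move=> lK e /lK [L [cL Le pL]]; exists (fun z => L (z.2, z.1)); split => //.
apply: (continuous_o (f := fun z : R * R => (z.2, z.1))) cL.
by apply: continuous_pair; [exact: continuous_snd'|exact: continuous_fst'].
Qed.

(** The second lift starts at the value of the first at the corner [(m, c)]; unique lifting makes
    them agree on the whole line through it. *)
Lemma liftable_glue K a m b c d : a <= m -> m <= b -> c <= d ->
  liftable_on K a m c d -> liftable_on K m b c d -> liftable_on K a b c d.
Proof.
move=> am mb cd l1 l2 e /l1 [L1 [cL1 L1e pL1]].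
have [|L2 [cL2 L2e pL2]] := l2 (L1 (m, c)).
  by rewrite pL1 /= !clamp_id ?lexx ?am ?cd.
have edge t : L1 (m, t) = L2 (m, t).
  have cm (L : R * R -> E) : continuous L -> continuous (fun t => L (m, t)).
    move=> cL; apply: (continuous_o (f := fun t : R => (m, t))) cL.
    by apply: continuous_pair => r; [exact: cvg_cst|exact: cvg_id].
  apply: (@covering_unique (fun t => L1 (m, t)) (fun t => L2 (m, t)) c).
  - exact: cm.
  - exact: cm.
  - by move=> r; rewrite pL1 pL2 /= (@clamp_id _ a m) ?(@clamp_id _ m b) ?lexx ?am ?mb.
  - by rewrite L2e.
exists (fun z => if z.1 <= m then L1 z else L2 z); split.
- apply: (paste_continuous (a := fun z : R * R => z.1)) => //.
    exact: continuous_fst'.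
  by move=> [s t] /= ->; exact: edge.
- by rewrite /= am.
- move=> [s t] /=; case: ifPn => [sm|]; first by rewrite pL1 /= (clamp_left am mb).
  by rewrite -ltNge => /ltW ms; rewrite pL2 /= (clamp_right am mb).
Qed.

Lemma liftable_glue_snd K a b c m d : a <= b -> c <= m -> m <= d ->
  liftable_on K a b c m -> liftable_on K a b m d -> liftable_on K a b c d.
Proof.
move=> ab cm md /liftable_swap l1 /liftable_swap l2.
have /liftable_swap l := liftable_glue cm md ab l1 l2.
by move=> e /l [L [cL Le pL]]; exists L; split => // -[s t]; rewrite pL.
Qed.

Lemma liftable_small K a b c d (U : set B) : continuous K -> a <= b -> c <= d ->
  (forall e, U (p e) -> exists s, local_section U e s) ->
  (forall s t, a <= s <= b -> c <= t <= d -> U (K (s, t))) ->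
  liftable_on K a b c d.
Proof.
move=> cK ab cd secU KU e pe.
have [|s [cs se ps _]] := secU e; first by rewrite pe; apply: KU; rewrite lexx ?ab ?cd.
pose k (z : R * R) := K (clamp a b z.1, clamp c d z.2).
have Uk z : U (k z) by apply: KU; exact: clamp_itv.
exists (s \o k); split => [z||z] /=.
- apply: continuous_comp; last exact/cs/Uk.
  move: z; apply: (continuous_o _ cK); apply: continuous_pair.
    by apply: continuous_o; [exact: continuous_fst'|exact: clamp_continuous].
  by apply: continuous_o; [exact: continuous_snd'|exact: clamp_continuous].
- by rewrite /k /= !clamp_id ?lexx// -pe.
- exact/ps/Uk.
Qed.

(** A Lebesgue number for the preimages under [K] of the sets with sections. *)
Lemma lebesgue_square K : continuous K -> exists2 eps : R, 0 < eps &
  forall a c l, 0 <= a <= 1 -> 0 <= c <= 1 -> 0 <= l <= eps ->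
    liftable_on K a (a + l) c (c + l).
Proof.
have [_ secp _] := covp => cK.
pose P (eps : R) (z : R * R) := 0 < eps /\
    forall l, 0 <= l <= eps -> liftable_on K z.1 (z.1 + l) z.2 (z.2 + l).
have cpt : compact (`[0 : R, 1]%classic `*` `[0 : R, 1]%classic).
  by apply: compact_setX; exact: segment_compact.
have cov : \forall eps \near (0 : R)^'+,
    `[0 : R, 1]%classic `*` `[0 : R, 1]%classic `<=` P eps.
  move/compact_near_coveringP : cpt; apply.
  move=> [s t] _.
  have [U [oU Ub secU]] := secp (K (s, t)).
  have : nbhs (s, t) (K @^-1` U) by apply: cK; exact: open_nbhs_nbhs.
  move=> /nbhs_ballP [e /= e0 KU].
  (* Half of the radius is for the corner [(a, c)], half for the side [l]. *)
  exists (ball (s, t) (e / 2), [set r | 0 < r < e / 2]); first split.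
  - by apply: nbhsx_ballx; rewrite divr_gt0.
  - near=> r; apply/andP; split; near: r.
      exact: nbhs_right_gt.
    by apply: nbhs_right_lt; rewrite divr_gt0.
  move=> [[a c] r] /= [[/= sa tc] /andP[r0 re]]; split => //= l /andP[l0 lr].
  apply: (liftable_small cK _ _ secU); rewrite ?lerDl// => u v au cv.
  apply: KU; split => /=.
    move: sa; rewrite /ball /= !ltr_distl; lra.
  move: tc; rewrite /ball /= !ltr_distl; lra.
have : exists eps, `[0 : R, 1]%classic `*` `[0 : R, 1]%classic `<=` P eps.
  by near (0 : R)^'+ => eps; exists eps; near: eps.
move=> [eps epsP].
have Peps a c : 0 <= a <= 1 -> 0 <= c <= 1 -> P eps (a, c).
  by move=> a01 c01; apply: epsP; split; rewrite /= in_itv.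
exists eps => [|a c l a01 c01]; last by have [_] := Peps a c a01 c01; exact.
by have [] // := Peps 0 0; rewrite lexx ler01.
Unshelve. all: by end_near. Qed.

Lemma covering_lifting : lifting.
Proof.
have [cp _ _] := covp; split => //; last first.
  move=> g g' cg cg' g0 pg t t01.
  have cclip (h : R -> E) : continuous h -> continuous (fun t => h (clamp 0 1 t)).
    by move=> ch; apply: continuous_o ch; exact: clamp_continuous.
  have := @covering_unique _ _ 0 (cclip _ cg) (cclip _ cg') _ _ t.
  rewrite !(clamp_id t01); apply; last by rewrite !clamp_id ?lexx ?ler01.
  by move=> r; apply/pg/clamp_itv.
move=> K e cK pe.
have [eps eps0 small] := lebesgue_square cK.
have [n epsn] : exists n : nat, 2^-1 ^+ n <= eps.
  pose n := Num.Def.archi_bound (eps^-1); exists n.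
  have h : eps^-1 < 2 ^+ n.
    apply: lt_trans (archi_boundP _) _; first by rewrite invr_ge0 ltW.
    by rewrite -natrX ltr_nat ltn_expl.
  by rewrite exprVn invf_ple ?posrE ?exprn_gt0// ltW.
(* Squares of side [2^-1 ^+ n] are small enough; gluing four doubles the side, up to the unit square
   at [j = n]. *)
have big (j : nat) : (j <= n)%N -> forall a c l, l = 2^-1 ^+ (n - j) ->
    0 <= a -> 0 <= c -> a + l <= 1 -> c + l <= 1 ->
    liftable_on K a (a + l) c (c + l).
  elim: j => [_ a c l le a0 c0 al cl|j IH jn a c l le a0 c0 al cl].
    have l0 : 0 < l by rewrite le exprn_gt0// invr_gt0.
    by apply: small; [lra|lra|rewrite ltW//= le subn0].
  pose k : R := 2^-1 ^+ (n - j).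
  have k0 : 0 < k by rewrite exprn_gt0// invr_gt0.
  have lk : l = k + k by rewrite le /k -(subnSK jn) exprS; lra.
  have half a' c' : 0 <= a' -> 0 <= c' -> a' + k <= 1 -> c' + k <= 1 ->
    liftable_on K a' (a' + k) c' (c' + k) by exact: IH (ltnW jn) _ _ _ erefl.
  rewrite {}lk !addrA in al cl *.
  apply: (@liftable_glue _ _ (a + k)); [lra|lra|lra| |];
    apply: (@liftable_glue_snd _ _ _ _ (c + k)); [lra|lra|lra| | |lra|lra|lra| |];
    by apply: half; lra.
have l1 : liftable_on K 0 (0 + 1) 0 (0 + 1).
  by apply: (big n (leqnn n)); rewrite ?subnn ?add0r.
have [L [cL Le pL]] := l1 e pe.
exists L; split=> // s t s01 t01.
by rewrite pL /= !add0r !clamp_id.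
Qed.
End Covering.

(** * Lifting for composites, products and homeomorphisms *)

Section Stability.
Variable R : realType.

Lemma lifting_comp (E B C : topologicalType) (p : E -> B) (q : B -> C) :
  lifting R p -> lifting R q -> lifting R (q \o p).
Proof.
move=> [cp exp unp] [cq exq unq]; split.
- exact: continuous_o cp cq.
- move=> K e cK pe; have [L [cL Le qL]] := exq K (p e) cK pe.
  have [L' [cL' Le' pL]] := exp L e cL (esym Le).
  by exists L'; split => // s t s01 t01; rewrite /= pL ?qL.
- move=> g g' cg cg' g0 qpg; apply: unp => // t t01.
  apply: (unq (p \o g) (p \o g')) => //=; last by rewrite g0.
    exact: continuous_o cg cp.
  exact: continuous_o cg' cp.
Qed.

Lemma lifting_prod (E B E' B' : topologicalType) (p : E -> B) (p' : E' -> B') :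
  lifting R p -> lifting R p' -> lifting R (fun z => (p z.1, p' z.2)).
Proof.
move=> [cp exp unp] [cp' exp' unp']; split.
- apply: continuous_pair.
    by apply: (continuous_o _ cp); exact: continuous_fst'.
  by apply: (continuous_o _ cp'); exact: continuous_snd'.
- move=> K [e e'] cK /= pe.
  have cK1 : continuous (fun z => (K z).1).
    by apply: (continuous_o cK); exact: continuous_fst'.
  have cK2 : continuous (fun z => (K z).2).
    by apply: (continuous_o cK); exact: continuous_snd'.
  have [L [cL Le pL]] := exp _ e cK1 (congr1 fst pe).
  have [L' [cL' Le' pL']] := exp' _ e' cK2 (congr1 snd pe).
  exists (fun z => (L z, L' z)); split; first exact: continuous_pair.
    by rewrite Le Le'.
  by move=> s t s01 t01 /=; rewrite pL ?pL'//; case: (K _).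
- move=> g g' cg cg' g0 pg t t01.
  have cfst (h : R -> E * E') : continuous h -> continuous (fun t => (h t).1).
    by move=> ch; apply: (continuous_o ch); exact: continuous_fst'.
  have csnd (h : R -> E * E') : continuous h -> continuous (fun t => (h t).2).
    by move=> ch; apply: (continuous_o ch); exact: continuous_snd'.
  rewrite (surjective_pairing (g t)) (surjective_pairing (g' t)); congr pair.
    apply: (unp _ _ (cfst _ cg) (cfst _ cg')) => [|u u01|//]; first by rewrite g0.
    by have [] := pg u u01.
  apply: (unp' _ _ (csnd _ cg) (csnd _ cg')) => [|u u01|//]; first by rewrite g0.
  by have [] := pg u u01.
Qed.

Lemma homeomorphism_lifting (E B : topologicalType) (f : E -> B) :
  homeomorphism f -> lifting R f.
Proof.
move=> [cf [g [cg fK gK]]]; split => //.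
- move=> K e cK fe; exists (g \o K); split => [||s t _ _] /=.
  + exact: continuous_o cK cg.
  + by rewrite -fe fK.
  + by rewrite gK.
- by move=> h h' _ _ _ hh' t t01; rewrite -(fK (h t)) hh'// fK.
Qed.

End Stability.

(** * Two-sheeted coverings *)

Lemma double_covering_fiber (E B : topologicalType) (p : E -> B) :
  double_covering p -> forall b, exists U V, [/\ open U, U b,
    forall k : bool, open (V k), V true `&` V false = set0 &
    [/\ p @^-1` U = V true `|` V false,
      forall k e e', V k e -> V k e' -> p e = p e' -> e = e' &
      forall k, homeomorphism_on (V k) U p]].
Proof.
move=> [cp] /[swap] b /(_ b) [U [V [[oU Ub] oV VV pU hV]]].
exists U, V; split => //; split => // k e e' Ve Ve' pe.
have [_ [s [_ [_ _ ps _]]]] := hV k.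
by rewrite -(ps e) ?inE// pe ps ?inE.
Qed.

Lemma double_covering_map (E B : topologicalType) (p : E -> B) :
  double_covering p -> covering_map p.
Proof.
move=> dp; have [cp _] := dp; split => //.
  move=> b; have [U [V [oU Ub oV VV [pU Vinj hV]]]] := double_covering_fiber dp b.
  exists U; split => // e Ue.
  have [k Vke] : exists k, V k e.
    have : (p @^-1` U) e by [].
    by rewrite pU => -[]; [exists true|exists false].
  have [_ [s [cs [pV sU ps sp]]]] := hV k.
  exists s; split.
  - move: cs; rewrite continuous_open_subspace// => cs u Uu.
    by apply: cs; rewrite inE.
  - by rewrite ps// inE.
  - by move=> u Uu; rewrite sp// inE.
  - by rewrite sU.
move=> e e' pe ee'.
have [U [V [oU Ub oV VV [pU Vinj _]]]] := double_covering_fiber dp (p e).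
have Ve : (V true `|` V false) e by rewrite -pU.
have Ve' : (V true `|` V false) e' by rewrite -pU /preimage/= -pe.
case: Ve Ve' => Ve [] Ve'; try by case: ee'; exact: Vinj Ve Ve' pe.
  by exists (V true), (V false).
by exists (V false), (V true); rewrite setIC.
Qed.

Lemma double_covering_surj (E B : topologicalType) (p : E -> B) :
  double_covering p -> forall b, exists e, p e = b.
Proof.
move=> dp b; have [U [V [_ Ub _ _ [_ _ hV]]]] := double_covering_fiber dp b.
have [_ [s [_ [pV _ _ _]]]] := hV true.
by move: Ub; rewrite -pV => -[e _ <-]; exists e.
Qed.

(** Two of the three points lie in the same sheet. *)
Lemma double_covering_card (E B : topologicalType) (p : E -> B) :
  double_covering p -> forall e1 e2 e3, p e1 = p e2 -> p e1 = p e3 ->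
  [\/ e1 = e2, e1 = e3 | e2 = e3].
Proof.
move=> dp e1 e2 e3 p12 p13.
have [U [V [_ Ub _ _ [pU Vinj _]]]] := double_covering_fiber dp (p e1).
have V1 : (V true `|` V false) e1 by rewrite -pU.
have V2 : (V true `|` V false) e2 by rewrite -pU /preimage/= -p12.
have V3 : (V true `|` V false) e3 by rewrite -pU /preimage/= -p13.
by case: V1 V2 V3 => [] V1 [] V2 [] V3;
  first [by apply: Or31; exact: Vinj V1 V2 _ | by apply: Or32; exact: Vinj V1 V3 _
        |by apply: Or33; apply: (Vinj _ _ _ V2 V3); rewrite -p12].
Qed.

(** * Quotients by actions of the integers *)

Section Action.
Variables (R : realType) (X B : topologicalType) (P : X -> B).
Variables (act : int -> X -> X) (rho : X -> R).
Hypotheses (cP : continuous P) (oP : forall O, open O -> open (P @` O)).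
Hypothesis surjP : forall b, exists x, P x = b.
Hypothesis cact : forall k, continuous (act k).
Hypothesis act0 : forall x, act 0 x = x.
Hypothesis actD : forall k l x, act k (act l x) = act (k + l) x.
Hypothesis P_act : forall k x, P (act k x) = P x.
Hypothesis P_inj : forall x x', P x = P x' -> exists k, x' = act k x.
Hypothesis crho : continuous rho.
Hypothesis rho_act : forall k x, rho (act k x) = rho x + k%:~R.

Local Lemma P_rho_inj x x' : P x = P x' -> `|rho x' - rho x| < 1 -> x = x'.
Proof.
move=> /P_inj [k ->]; rewrite rho_act addrAC subrr add0r -intr_norm.
by rewrite -[1]/(1%:~R) ltr_int; case: k => [[|k]|k] //; rewrite act0.
Qed.

(** A slab of width less than 1 for [rho] meets each orbit at most once, so it maps injectively; its
    translates are the other sheets. *)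
Lemma action_covering_map : covering_map P.
Proof.
have oslab (a b : R) : open [set x | a < rho x < b].
  have -> : [set x | a < rho x < b] = rho @^-1` `]a, b[%classic.
    by apply/seteqP; split => x /=; rewrite in_itv.
  by move/continuousP : crho; apply; exact: interval_open.
split => //.
  move=> b; have [x0 <-] := surjP b.
  pose V := [set x | rho x0 - 4^-1 < rho x < rho x0 + 4^-1].
  have oV : open V by exact: oslab.
  have Vinj x x' : V x -> V x' -> P x = P x' -> x = x'.
    by rewrite /V /= => Vx Vx' Px; apply: P_rho_inj => //; rewrite ltr_norml; lra.
  exists (P @` V); split; [exact: oP|by exists x0 => //; rewrite /V/=; lra|].
  move=> e [v Vv Pv]; have [k ek] := P_inj Pv.
  (* The inverse of [P] on the slab; the default [x0] is irrelevant, as [c] is evaluated only on the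
     image of [V]. *)
  pose c u := xget x0 (V `&` P @^-1` [set u]).
  have cV u : (P @` V) u -> V (c u) /\ P (c u) = u.
    by move=> [w Vw Pw]; apply: (@xgetPex _ x0 (V `&` P @^-1` [set u])); exists w.
  have cP' w : V w -> c (P w) = w.
    move=> Vw; have [] := cV (P w); first by exists w.
    by move=> Vc; exact: Vinj.
  exists (act k \o c); split.
  - move=> u Uu; apply: continuous_comp; last exact: cact.
    move=> O; rewrite nbhsE => -[O' [oO' O'c] O'O].
    have [Vc Pc] := cV u Uu.
    rewrite /= nbhsE; exists (P @` (O' `&` V)); last first.
      by move=> _ [w [O'w Vw] <-]; apply: O'O; rewrite /= cP'.
    split; last by exists (c u).
    by apply: oP; exact: openI.
  - by rewrite /= -Pv cP'.
  - by move=> u Uu /=; rewrite P_act; have [] := cV u Uu.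
  - have -> : (act k \o c) @` (P @` V) = act (- k) @^-1` V.
      apply/seteqP; split => [_ [_ [w Vw <-] <-]|w /= Vw].
        by rewrite /= cP'// actD addNr act0.
      exists (P (act (- k) w)); first by exists (act (- k) w).
      by rewrite /= cP'// actD addrN act0.
    by move/continuousP : (@cact (- k)); apply.
move=> e e' Pe ee'; have [k e'k] := P_inj Pe.
have k1 : 1 <= `|rho e' - rho e|.
  by rewrite leNgt; apply/negP => lt1; apply/ee'/P_rho_inj.
exists [set x | rho e - 2^-1 < rho x < rho e + 2^-1].
exists [set x | rho e' - 2^-1 < rho x < rho e' + 2^-1].
split => /=; [exact: oslab|exact: oslab|lra|lra|].
rewrite -subset0 => x /= [xe xe']; move: k1; rewrite leNgt => /negP; apply.
by rewrite ltr_norml; lra.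
Qed.

End Action.

(** * The coverings of the torus and of a mapping torus *)

Lemma quot_open (T : topologicalType) (r : T -> T -> Prop) (U : set (quot r)) :
  open (@quot_pi T r @^-1` U) -> open U.
Proof. by []. Qed.

Lemma quot_surj (T : topologicalType) (r : T -> T -> Prop) (z : quot r) :
  exists x, quot_pi r x = z.
Proof. by exists (repr z); exact: reprK. Qed.

Section Circle.
Variable R : realType.

Lemma circle_piP (a b : R) :
  circle_pi a = circle_pi b <-> exists m : int, b = a + m%:~R.
Proof.
split=> [/quot_piP|[m ->]]; last by apply/quot_piP/rst_step; exists m.
elim=> [x y [m ->]|x|x y _ [m ->]|x y z _ [m ->] _ [n ->]].
- by exists m.
- by exists 0; rewrite addr0.
- by exists (- m); rewrite rmorphN /= addrK.
- by exists (m + n); rewrite rmorphD /= addrA.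
Qed.

Lemma continuous_addr_cst (a : R) : continuous (fun r : R => r + a).
Proof. by move=> r; apply: cvgD; [exact: cvg_id|exact: cvg_cst]. Qed.

Lemma circle_pi_covering : covering_map (@circle_pi R).
Proof.
apply: (@action_covering_map R R (circle R) (@circle_pi R)
  (fun k r => r + k%:~R) id).
- exact: quot_pi_continuous.
- move=> O oO; apply: quot_open.
  have -> : quot_pi _ @^-1` (@circle_pi R @` O) =
      \bigcup_(m in [set: int]) (fun r => r + m%:~R) @^-1` O.
    apply/seteqP; split => [r [s Os /esym/circle_piP [m ms]]|r [m _ /= Om]].
      by exists m => //=; rewrite -ms.
    by exists (r + m%:~R) => //; apply/esym/circle_piP; exists m.
  apply: bigcup_open => m _.
  by have /continuousP := @continuous_addr_cst m%:~R; apply.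
- exact: quot_surj.
- by move=> k; exact: continuous_addr_cst.
- by move=> r; rewrite addr0.
- by move=> k l r; rewrite -addrA -rmorphD addrC /= addrC [k + l]addrC.
- by move=> k r; apply/esym/circle_piP; exists k.
- by move=> r s /circle_piP.
- by move=> r; exact: cvg_id.
- by [].
Qed.

Definition torus_pi (z : R * R) : torus R := (circle_pi z.1, circle_pi z.2).

Lemma torus_pi_lifting : lifting R torus_pi.
Proof.
have lc : lifting R (@circle_pi R).
  by apply: covering_lifting; exact: circle_pi_covering.
exact: (lifting_prod lc lc).
Qed.

Lemma torus_pi_surj (w : torus R) : exists z, torus_pi z = w.
Proof.
have [[a aw] [b bw]] := (quot_surj w.1, quot_surj w.2).
by exists (a, b); rewrite /torus_pi /circle_pi /= aw bw; case: w {aw bw}.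
Qed.

End Circle.

Section MappingTorus.
Variables (R : realType) (f g : torus R -> torus R).
Hypotheses (cf : continuous f) (cg : continuous g).
Hypotheses (fK : cancel f g) (gK : cancel g f).
Local Notation T := (torus R).
Local Notation I := (unit_interval R).

Definition fz (k : int) : T -> T :=
  match k with Posz n => iter n f | Negz n => iter n.+1 g end.

Lemma fzS k x : fz (k + 1) x = f (fz k x).
Proof.
case: k => [n|[|n]]; first by rewrite -[1]/(1%:Z) -PoszD addn1.
  by rewrite NegzE addNr /= gK.
rewrite [in LHS]NegzE -addn1 PoszD opprD addrNK -NegzE.
exact: esym (gK _).
Qed.

Lemma fzP k x : fz (k - 1) x = g (fz k x).
Proof. by rewrite -[in RHS](subrK 1 k) fzS fK. Qed.

Lemma fzD k l x : fz (k + l) x = fz k (fz l x).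
Proof.
elim/int_ind: k => [|n IH|n IH]; first by rewrite add0r.
  by rewrite -addn1 PoszD addrAC !fzS IH.
by rewrite -addn1 PoszD opprD addrAC !fzP IH.
Qed.

Lemma fz_continuous k : continuous (fz k).
Proof.
elim/int_ind: k => [x|n IH|n IH]; first exact: cvg_id.
  rewrite (_ : fz _ = f \o fz n); first exact: continuous_o IH cf.
  by apply/funext => x; rewrite -addn1 PoszD fzS.
rewrite (_ : fz _ = g \o fz (- n%:Z)); first exact: continuous_o IH cg.
by apply/funext => x; rewrite -addn1 PoszD opprD fzP.
Qed.

(* The deck transformations of the infinite cyclic covering [mt_pi] below. *)
Definition mt_act (k : int) (z : T * R) : T * R := (fz (- k) z.1, z.2 + k%:~R).

(** The covering on the slab between heights [n] and [n + 1]; each slab applies [f] once more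
    because [(y, 1)] is glued to [(f y, 0)]. Clipping makes the slice continuous everywhere. *)
Definition mt_slice (n : int) (z : T * R) : mapping_torus f :=
  quot_pi _ (fz n z.1, clip (z.2 - n%:~R)).

Definition mt_pi (z : T * R) : mapping_torus f := mt_slice (Num.floor z.2) z.

Lemma mt_slice_continuous n : continuous (mt_slice n).
Proof.
apply: (continuous_o _ (@quot_pi_continuous _ _)); apply: continuous_pair.
  by apply: (continuous_o _ (@fz_continuous n)); exact: continuous_fst'.
apply: (continuous_o _ (@clip_continuous R)).
apply: (continuous_o (g := fun r : R => r - n%:~R)); first exact: continuous_snd'.
exact: continuous_addr_cst.
Qed.

Lemma mt_slice_glue n y : mt_slice (n + 1) (y, (n + 1)%:~R) = mt_slice n (y, (n + 1)%:~R).
Proof.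
apply/esym/quot_piP/rst_step; rewrite /= subrr rmorphD /= addrAC subrr add0r fzS.
by split.
Qed.

Lemma mt_pi_slice n z : n%:~R <= z.2 <= (n + 1)%:~R -> mt_pi z = mt_slice n z.
Proof.
case: z => y r /= /andP[nr]; rewrite le_eqVlt => /orP[/eqP ->|rn].
  by rewrite /mt_pi /= intrKfloor mt_slice_glue.
by rewrite /mt_pi /= (@floor_def _ _ n) ?nr.
Qed.

Lemma mt_pi_continuous : continuous mt_pi.
Proof.
move=> [y r].
(* One below the floor, so that [r] is interior to two adjacent slabs even if it is an integer. *)
pose n := Num.floor r - 1.
pose h z := if z.2 <= (n + 1)%:~R then mt_slice n z else mt_slice (n + 1) z.
have ch : continuous h.
  apply: (paste_continuous (a := fun z : T * R => z.2)).
  - exact: continuous_snd'.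
  - exact: mt_slice_continuous.
  - exact: mt_slice_continuous.
  - by move=> [w t] /= ->; rewrite mt_slice_glue.
have hE z : n%:~R <= z.2 <= (n + 1 + 1)%:~R -> mt_pi z = h z.
  move=> nz; rewrite /h; case: ifPn => zn; first by apply: mt_pi_slice; lra.
  by apply: mt_pi_slice; rewrite -ltNge in zn; lra.
have /andP[r1 r2] := Num.Theory.real_floor_itv (num_real r).
have nr : n%:~R < r < (n + 1 + 1)%:~R.
  rewrite /n; move: r1 r2; rewrite !rmorphD !rmorphN /= => r1 r2; lra.
have nE : \forall z \near ((y, r) : T * R), h z = mt_pi z.
  have : \forall z \near ((y, r) : T * R), n%:~R < z.2 < (n + 1 + 1)%:~R.
    apply: (@cvg_snd _ _ (nbhs y) (nbhs r) _ [set t | n%:~R < t < (n + 1 + 1)%:~R]).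
    apply: open_nbhs_nbhs; split => //=.
    have -> : [set t : R | n%:~R < t < (n + 1 + 1)%:~R] = `]n%:~R, (n + 1 + 1)%:~R[%classic.
      by apply/seteqP; split => t /=; rewrite in_itv.
    exact: interval_open.
  by apply: filterS => z /andP[/ltW z1 /ltW z2]; rewrite hE// z1.
rewrite /continuous_at hE; last by have /andP[/ltW -> /ltW ->] := nr.
by apply: cvg_trans (ch (y, r)); exact: near_eq_cvg nE.
Qed.

Lemma mt_pi_act k z : mt_pi (mt_act k z) = mt_pi z.
Proof.
rewrite /mt_pi /mt_slice /mt_act /= floorDrz ?intr_int// intrKfloor.
rewrite -fzD addrK rmorphD /=; congr (quot_pi _ (_, clip _)).
by rewrite opprD addrACA subrr addr0.
Qed.

Lemma mt_quotP (a b : T * I) : quot_pi _ a = quot_pi _ b :> mapping_torus f ->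
  exists k : int, b.1 = fz (- k) a.1 /\ uival b.2 = uival a.2 + k%:~R.
Proof.
move/quot_piP; elim=> [{}a {}b [a2 b2 b1]|{}a|{}a {}b _ [k [e1 e2]]
  |{}a {}b c _ [k [e1 e2]] _ [l [e3 e4]]].
- exists (-1); rewrite opprK /= b1; split => //.
  by rewrite a2 b2 uival_one uival_zero subrr.
- by exists 0; rewrite oppr0 addr0.
- exists (- k); rewrite e1 -fzD e2 opprK subrr; split => //.
  by rewrite rmorphN addrK.
- by exists (k + l); rewrite e3 e1 -fzD e4 e2 rmorphD opprD addrA [- l - k]addrC.
Qed.

Lemma mt_pi_inj z z' : mt_pi z = mt_pi z' -> exists k, z' = mt_act k z.
Proof.
case: z z' => [y r] [y' r'] /mt_quotP [k /=].
have fl01 (t : R) : 0 <= t - (Num.floor t)%:~R <= 1.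
  have /andP[r1 r2] := Num.Theory.real_floor_itv (num_real t).
  by move: r1 r2; rewrite !rmorphD /= => r1 r2; lra.
rewrite !uival_clip_id// => -[ye re].
exists (Num.floor r' - Num.floor r + k); rewrite /mt_act /=; congr pair; last first.
  by rewrite !rmorphD rmorphN /=; lra.
have := congr1 (fz (- Num.floor r')) ye; rewrite -!fzD addNr /= => ->.
by congr (fz _ y); lra.
Qed.

Lemma mt_pi_clip (a : T * I) : mt_pi (a.1, uival a.2) = quot_pi _ a.
Proof.
rewrite (@mt_pi_slice 0) /= ?add0r ?uival_itv//.
by rewrite /mt_slice /= subr0 clipK; case: a.
Qed.

Lemma mt_pi_surj b : exists z, mt_pi z = b.
Proof. by have [a <-] := quot_surj b; exists (a.1, uival a.2); exact: mt_pi_clip. Qed.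

Lemma mt_act_continuous k : continuous (mt_act k).
Proof.
apply: continuous_pair.
  by apply: (continuous_o _ (@fz_continuous _)); exact: continuous_fst'.
apply: (continuous_o (g := fun r : R => r + k%:~R)); first exact: continuous_snd'.
exact: continuous_addr_cst.
Qed.

Lemma mt_pi_covering : covering_map mt_pi.
Proof.
apply: (@action_covering_map R (T * R)%type (mapping_torus f) mt_pi mt_act snd).
- exact: mt_pi_continuous.
- move=> O oO; apply: quot_open.
  have -> : quot_pi _ @^-1` (mt_pi @` O) = \bigcup_(m in [set: int])
      (fun a : T * I => mt_act m (a.1, uival a.2)) @^-1` O.
    apply/seteqP; split => [a [z Oz /esym]|a [m _ /= Om]].
      by rewrite -mt_pi_clip => /mt_pi_inj [m zE]; exists m => //=; rewrite -zE.
    by exists (mt_act m (a.1, uival a.2)) => //; rewrite mt_pi_act mt_pi_clip.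
  apply: bigcup_open => m _.
  suff /continuousP : continuous (fun a : T * I => mt_act m (a.1, uival a.2)) by apply.
  apply: (continuous_o (f := fun a : T * I => (a.1, uival a.2)) (g := mt_act m));
    last exact: mt_act_continuous.
  apply: continuous_pair; first exact: continuous_fst'.
  by apply: continuous_o; [exact: continuous_snd'|exact: uival_continuous].
- exact: mt_pi_surj.
- exact: mt_act_continuous.
- by move=> [y r]; rewrite /mt_act /= addr0.
- by move=> k l [y r]; rewrite /mt_act /= -fzD -opprD -addrA -rmorphD [l + k]addrC.
- exact: mt_pi_act.
- exact: mt_pi_inj.
- exact: continuous_snd'.
- by [].
Qed.

End MappingTorus.

(** * Endpoints of lifted loops *)

Section Ends.
Variables (R : realType).
Local Notation I := (unit_interval R).

(** The lift of [c] from [e] ends at [e']; outside the unit interval [g] is an arbitrary continuous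
    extension. *)
Definition ends (X B : topologicalType) (P : X -> B) (c : I -> B) (e e' : X) :=
  exists g : R -> X, [/\ continuous g, g 0 = e, g 1 = e' &
    forall t, 0 <= t <= 1 -> P (g t) = c (clip t)].

Let r01 : (0 : R) <= (0 : R) <= 1. Proof. by rewrite lexx ler01. Qed.
Let r11 : (0 : R) <= (1 : R) <= 1. Proof. by rewrite lexx ler01. Qed.

Lemma ends_comp (X E B : topologicalType) (Q : X -> E) (d : E -> B)
    (c : I -> B) e e' :
  continuous Q -> ends (d \o Q) c e e' -> ends d c (Q e) (Q e').
Proof.
move=> cQ [g [cg g0 g1 pg]]; exists (Q \o g); split; rewrite /= ?g0 ?g1//.
exact: continuous_o cg cQ.
Qed.

Lemma ends_map (X B X' B' : topologicalType) (P : X -> B) (P' : X' -> B')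
    (i : X -> X') (j : B -> B') (c : I -> B) e e' : continuous i ->
  (forall z, P' (i z) = j (P z)) -> ends P c e e' ->
  ends P' (j \o c) (i e) (i e').
Proof.
move=> ci Pi [g [cg g0 g1 pg]]; exists (i \o g); split; rewrite /= ?g0 ?g1//.
  exact: continuous_o cg ci.
by move=> t t01; rewrite Pi pg.
Qed.

Variables (X B : topologicalType) (P : X -> B).

Lemma ends_line (g : R -> X) (c : I -> B) : continuous g ->
  (forall t, c t = P (g (uival t))) -> ends P c (g 0) (g 1).
Proof. by move=> cg cE; exists g; split => // t t01; rewrite cE uival_clip_id. Qed.

Lemma ends_cat x y z (p : {path I from x to y in B}) (q : {path I from y to z in B})
    e e' e'' : ends P p e e' -> ends P q e' e'' -> ends P (path_cat p q) e e''.
Proof.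
move=> [g [cg g0 g1 pg]] [h [ch h0 h1 ph]].
have aff (k : R -> X) (a b : R) : continuous k -> continuous (fun t : R => k (t * a + b)).
  move=> ck; apply: (continuous_o (X := R) (Y := R) (f := fun t : R => t * a + b) _ ck) => r.
  by apply: cvgD; [exact: cvgM cvg_id (cvg_cst _)|exact: cvg_cst].
exists (fun t : R => if t <= 2^-1 then g (t * 2 + 0) else h (t * 2 + -1)); split.
- apply: (paste_continuous (a := id)); [by move=> r; exact: cvg_id|exact: aff|exact: aff|].
  by move=> t /= ->; rewrite mulVf ?pnatr_eq0// addr0 subrr g1 h0.
- by rewrite invr_ge0 ler0n mul0r addr0.
- rewrite ifF; last by apply/negbTE; rewrite -ltNge; lra.
  by rewrite -h1; congr h; lra.
- move=> t t01; rewrite path_catE //; case: ifPn => t2.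
    by rewrite addr0 pg//; lra.
  by rewrite -ltNge in t2; rewrite ph//; lra.
Qed.

Lemma ends_rev x y (p : {path I from x to y in B}) e e' :
  ends P p e e' -> ends P (path_rev p) e' e.
Proof.
move=> [g [cg g0 g1 pg]]; exists (fun t => g (1 - t)); split.
- apply: (continuous_o (X := R) (Y := R) (f := fun t : R => 1 - t) _ cg) => r.
  by apply: cvgB; [exact: cvg_cst|exact: cvg_id].
- by rewrite subr0.
- by rewrite subrr.
- move=> t t01; rewrite pg; last lra.
  by rewrite -[RHS]/(p (clip (1 - uival (clip t)))) uival_clip_id.
Qed.

Lemma ends_cst e : ends P (path_cst (P e)) e e.
Proof. by exists (fun=> e); split => // r; exact: cvg_cst. Qed.

Hypothesis lP : lifting R P.

Lemma ends_exists (c : I -> B) e : continuous c -> P e = c zero ->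
  exists e', ends P c e e'.
Proof.
have [_ ex _] := lP => cc Pe.
have cK : continuous (fun z : R * R => c (clip z.1)).
  apply: (continuous_o _ cc); apply: continuous_o; last exact: clip_continuous.
  exact: continuous_fst'.
have [L [cL L0 pL]] := ex _ e cK Pe.
exists (L (1, 0)); exists (fun s => L (s, 0)); split => //.
  apply: (continuous_o (X := R) (Y := (R * R)%type) (f := fun s : R => (s, 0)) _ cL).
  apply: continuous_pair => r.
    exact: cvg_id.
  exact: cvg_cst.
by move=> t t01; rewrite pL.
Qed.

Lemma ends_unique (c : I -> B) e e1 e2 : ends P c e e1 -> ends P c e e2 -> e1 = e2.
Proof.
have [_ _ un] := lP => -[g [cg g0 g1 pg]] [h [ch h0 h1 ph]].
rewrite -g1 -h1; apply: un => //; first by rewrite g0 h0.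
by move=> t t01; rewrite pg// ph.
Qed.

(** Lift the homotopy: its two constant sides lift to constant paths, so the endpoints of the lift
    do not move. *)
Lemma ends_square (H : I * I -> B) e e' : continuous H ->
  (forall s, H (s, zero) = H (zero, zero)) ->
  (forall s, H (s, one) = H (zero, one)) ->
  ends P (fun t => H (zero, t)) e e' -> ends P (fun t => H (one, t)) e e'.
Proof.
have [_ ex un] := lP => cH Hx Hy [g [cg g0 g1 pg]].
have cK : continuous (fun z : R * R => H (clip z.1, clip z.2)).
  apply: (continuous_o (f := fun z : R * R => (clip z.1, clip z.2)) _ cH).
  apply: continuous_pair; apply: continuous_o; try exact: clip_continuous.
    exact: continuous_fst'.
  exact: continuous_snd'.
have Pe : P e = H (clip 0, clip 0) by rewrite -g0 pg.
have [L [cL L0 pL]] := ex _ e cK Pe.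
have cLl s : continuous (fun t => L (s, t)).
  apply: (continuous_o (X := R) (Y := (R * R)%type) (f := fun t : R => (s, t)) _ cL).
  by apply: continuous_pair => r; [exact: cvg_cst|exact: cvg_id].
have cLr t : continuous (fun s => L (s, t)).
  apply: (continuous_o (X := R) (Y := (R * R)%type) (f := fun s : R => (s, t)) _ cL).
  by apply: continuous_pair => r; [exact: cvg_id|exact: cvg_cst].
have L01 : L (0, 1) = e'.
  rewrite -g1; apply: (un (fun t => L (0, t)) g) => //; first by rewrite L0 g0.
  by move=> t t01; rewrite pL// pg.
have cc (a : X) : continuous (fun _ : R => a) by move=> r; exact: cvg_cst.
have L11 : L (1, 1) = e'.
  rewrite -L01; apply: (un (fun s => L (s, 1)) (fun=> L (0, 1))) => //.
  by move=> t t01; rewrite !pL//= Hy [RHS]Hy.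
have L10 : L (1, 0) = e.
  rewrite -L0; apply: (un (fun s => L (s, 0)) (fun=> L (0, 0))) => //.
  by move=> t t01; rewrite !pL//= Hx [RHS]Hx.
by exists (fun t => L (1, t)); split => // t t01; rewrite pL.
Qed.

Lemma ends_homotopic x y (p q : {path I from x to y in B}) e e' :
  path_homotopic p q -> ends P p e e' -> ends P q e e'.
Proof.
move=> [H [cH H0 H1 Hxy]].
rewrite (_ : p = (fun t => H (zero, t)) :> (I -> B)); last exact/esym/funext.
rewrite (_ : q = (fun t => H (one, t)) :> (I -> B)); last exact/esym/funext.
by apply: ends_square => // s; [rewrite !(Hxy _).1|rewrite !(Hxy _).2].
Qed.

Section SimplyConnected.
Variable h : R * (X * X) -> X.
Hypotheses (ch : continuous h) (h0 : forall a b, h (0, (a, b)) = a).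
Hypotheses (h1 : forall a b, h (1, (a, b)) = b) (hh : forall s a, h (s, (a, a)) = a).

(** Contract one lift to the other along [h] and project; [h] is stationary on the diagonal, so the
    endpoints stay fixed. *)
Lemma ends_inj x y (p q : {path I from x to y in B}) e e' :
  ends P p e e' -> ends P q e e' -> path_homotopic p q.
Proof.
have [cP _ _] := lP => -[g [cg g0 g1 pg]] [g' [cg' g'0 g'1 pg']].
exists (fun z => P (h (uival z.1, (g (uival z.2), g' (uival z.2))))); split.
- apply: (continuous_o _ cP).
  apply: (continuous_o (f := fun z : I * I => (uival z.1, (g (uival z.2), g' (uival z.2)))) _ ch).
  apply: continuous_pair.
    by apply: continuous_o; [exact: continuous_fst'|exact: uival_continuous].
  have c2 : continuous (fun z : I * I => uival z.2).
    by apply: continuous_o; [exact: continuous_snd'|exact: uival_continuous].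
  by apply: continuous_pair; [exact: (continuous_o c2 cg)|exact: (continuous_o c2 cg')].
- by move=> t /=; rewrite uival_zero h0 pg ?uival_itv// clipK.
- by move=> t /=; rewrite uival_one h1 pg' ?uival_itv// clipK.
- move=> s /=; rewrite uival_zero uival_one g0 g1 g'0 g'1 !hh; split.
    by rewrite -g0 pg//; exact: path_zero.
  by rewrite -g1 pg//; exact: path_one.
Qed.

End SimplyConnected.

Section Pi1.
Variable x : B.
Implicit Types a b : pi1 R x.

Definition pend a e e' := ends P (repr a) e e'.

Lemma pend_class (p : {path I from x to x in B}) e e' :
  pend (pi1_class p) e e' <-> ends P p e e'.
Proof.
split; first by apply: ends_homotopic; exact: repr_pi1_class.
by apply: ends_homotopic; apply: path_homotopic_sym; exact: repr_pi1_class.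
Qed.

Lemma loop_class (c : I -> B) : continuous c -> c zero = x -> c one = x ->
  exists a : pi1 R x, forall e e', pend a e e' <-> ends P c e e'.
Proof.
move=> cc c0 c1; exists (pi1_class (mk_path cc c0 c1)) => e e'.
exact: pend_class.
Qed.

Lemma pend_exists a e : P e = x -> exists e', pend a e e'.
Proof.
move=> Pe; apply: ends_exists; first exact: cts_fun.
by rewrite path_zero.
Qed.

Lemma pend_unique a e e1 e2 : pend a e e1 -> pend a e e2 -> e1 = e2.
Proof. exact: ends_unique. Qed.

Lemma pend_over a e e' : pend a e e' -> P e = x /\ P e' = x.
Proof.
move=> [g [cg g0 g1 pg]]; rewrite -{1}g0 -{1}g1 !pg//; split.
  exact: path_zero.
exact: path_one.
Qed.

Lemma pendM a b e e' e'' : pend a e e' -> pend b e' e'' -> pend (a * b)%g e e''.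
Proof.
move=> ae be; rewrite -(pi1_repr a) -(pi1_repr b) pi1_classM pend_class.
exact: ends_cat ae be.
Qed.

Lemma pendV a e e' : pend a e e' -> pend a^-1%g e' e.
Proof.
by move=> ae; rewrite -(pi1_repr a) pi1_classV pend_class; exact: ends_rev.
Qed.

Lemma pend1 e : P e = x -> pend 1%g e e.
Proof. by move=> Pe; rewrite -pi1_class1 pend_class -Pe; exact: ends_cst. Qed.

End Pi1.
End Ends.

(** * The fundamental group of a space covered by a mapping torus *)

Section Plane.
Variable R : realType.

Lemma continuous_lin (Z : topologicalType) (s u v : Z -> R) :
  continuous s -> continuous u -> continuous v ->
  continuous (fun z => u z + s z * (v z - u z)).
Proof.
move=> cs cu cv z; apply: cvgD; first exact: cu.
by apply: cvgM; [exact: cs|apply: cvgB; [exact: cv|exact: cu]].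
Qed.

Definition shift (y : R * R) (n : 'cV[int]_2) : R * R :=
  (y.1 + (n 0 0)%:~R, y.2 + (n 1 0)%:~R).

Lemma shift0 y : shift y 0 = y.
Proof. by rewrite /shift !mxE !addr0; case: y. Qed.

Lemma shiftD y m n : shift (shift y m) n = shift y (m + n).
Proof. by rewrite /shift /= !mxE !rmorphD !addrA. Qed.

Lemma shift_inj y : injective (shift y).
Proof.
move=> m n [] /addrI /intr_inj e0 /addrI /intr_inj e1.
apply/matrixP => i j; rewrite ord1.
by have /orP[/eqP ->|/eqP ->] : (i == 0) || (i == 1) by case: i => [[|[]]].
Qed.

Lemma torus_piP y y' : torus_pi y = torus_pi y' <-> exists n, y' = shift y n.
Proof.
split=> [[/circle_piP [a ya] /circle_piP [b yb]]|[n ->]].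
  exists (\col_i if i == 0 then a else b).
  by rewrite /shift !mxE /= -ya -yb; case: y' {ya yb}.
by congr pair; apply/circle_piP; [exists (n 0 0)|exists (n 1 0)].
Qed.

Lemma torus_pi_shift y n : torus_pi (shift y n) = torus_pi y.
Proof. by apply/esym/torus_piP; exists n. Qed.

Definition seg (y : R * R) (v : R * R) (t : R) : R * R := (y.1 + t * v.1, y.2 + t * v.2).

Lemma seg_continuous y v : continuous (seg y v).
Proof.
apply: (continuous_pair (f := fun t : R => y.1 + t * v.1) (g := fun t => y.2 + t * v.2)) => t;
  by apply: cvgD; [exact: cvg_cst|exact: cvgM cvg_id (cvg_cst _)].
Qed.

Definition ivec (n : 'cV[int]_2) : R * R := ((n 0 0)%:~R, (n 1 0)%:~R).

Lemma seg0 y v : seg y v 0 = y.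
Proof. by rewrite /seg !mul0r !addr0; case: y. Qed.

Lemma seg1 y n : seg y (ivec n) 1 = shift y n.
Proof. by rewrite /seg !mul1r. Qed.

Lemma torus_pi_seg y y' v t : torus_pi y = torus_pi y' ->
  torus_pi (seg y v t) = torus_pi (seg y' v t).
Proof.
move=> /torus_piP [n ->]; apply/torus_piP; exists n.
by rewrite /seg /shift /= addrAC [y.2 + _ + _]addrAC.
Qed.

Lemma torus_line_seg y n t :
  torus_line (torus_pi y) n t = torus_pi (seg y (ivec n) (uival t)).
Proof.
rewrite -[LHS]/(torus_pi (seg (repr (torus_pi y).1, repr (torus_pi y).2) (ivec n) (uival t))).
apply: torus_pi_seg; rewrite {1}/torus_pi /=.
by congr pair; exact: reprK.
Qed.

Definition convex3 (z : R * ((R * R * R) * (R * R * R))) : R * R * R :=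
  let: (s, (a, b)) := z in
  (a.1.1 + s * (b.1.1 - a.1.1), a.1.2 + s * (b.1.2 - a.1.2), a.2 + s * (b.2 - a.2)).

Lemma convex3_continuous : continuous convex3.
Proof.
pose a1 (z : R * ((R * R * R) * (R * R * R))) := z.2.1.
pose b1 (z : R * ((R * R * R) * (R * R * R))) := z.2.2.
have c2 : continuous (fun z : R * ((R * R * R) * (R * R * R)) => z.2).
  exact: continuous_snd'.
have ca : continuous a1 by apply: (continuous_o c2); exact: continuous_fst'.
have cb : continuous b1 by apply: (continuous_o c2); exact: continuous_snd'.
have cs : continuous (fun z : R * ((R * R * R) * (R * R * R)) => z.1).
  exact: continuous_fst'.
have c12 (k : R * ((R * R * R) * (R * R * R)) -> R * R * R) : continuous k ->
  [/\ continuous (fun z => (k z).1.1), continuous (fun z => (k z).1.2)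
    & continuous (fun z => (k z).2)].
  move=> ck; have ck1 : continuous (fun z => (k z).1).
    by apply: (continuous_o ck); exact: continuous_fst'.
  split.
  - by apply: (continuous_o ck1); exact: continuous_fst'.
  - by apply: (continuous_o ck1); exact: continuous_snd'.
  - by apply: (continuous_o ck); exact: continuous_snd'.
have [ca1 ca2 ca3] := c12 _ ca; have [cb1 cb2 cb3] := c12 _ cb.
rewrite (_ : convex3 = fun z => (((a1 z).1.1 + z.1 * ((b1 z).1.1 - (a1 z).1.1),
   (a1 z).1.2 + z.1 * ((b1 z).1.2 - (a1 z).1.2)), (a1 z).2 + z.1 * ((b1 z).2 - (a1 z).2))).
  by apply: continuous_pair; [apply: continuous_pair|]; exact: continuous_lin.
by apply/funext => -[s [a b]].
Qed.

Lemma convex3_0 a b : convex3 (0, (a, b)) = a.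
Proof. by rewrite /convex3 !mul0r !addr0; case: a => -[]. Qed.

Lemma convex3_1 a b : convex3 (1, (a, b)) = b.
Proof.
by rewrite /convex3 !mul1r addrC subrK addrC subrK addrC subrK; case: b => -[].
Qed.

Lemma convex3_id s a : convex3 (s, (a, a)) = a.
Proof. by rewrite /convex3 !subrr !mulr0 !addr0; case: a => -[]. Qed.

End Plane.

Section Monodromy.
Variables (R : realType) (f : continuousType (torus R) (torus R)).
Variables (g : torus R -> torus R) (A : 'M[int]_2).
Hypotheses (cg : continuous g) (fK : cancel f g) (gK : cancel g f).
Hypothesis fA : acts_on_pi1_by f A.
Variables (M : topologicalType) (d : mapping_torus f -> M).
Hypothesis ld : lifting R d.
Hypothesis fib : forall e1 e2 e3, d e1 = d e2 -> d e1 = d e3 ->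
  [\/ e1 = e2, e1 = e3 | e2 = e3].
Local Notation T := (torus R).
Local Notation I := (unit_interval R).
Local Notation X := (R * R * R)%type.
Local Notation mtpi := (@mt_pi R f g).

Let cf : continuous f. Proof. exact: cts_fun. Qed.

Definition tpi (z : X) : T * R := (torus_pi z.1, z.2).
Definition upi (z : X) : mapping_torus f := mtpi (tpi z).
Definition vpi (z : X) : M := d (upi z).

Lemma tpi_lifting : lifting R tpi.
Proof.
apply: (lifting_prod (torus_pi_lifting R) (p' := fun r : R => r)).
apply: homeomorphism_lifting; split; first by move=> r; exact: cvg_id.
by exists id; split => // r; exact: cvg_id.
Qed.

Lemma mtpi_lifting : lifting R mtpi.
Proof. by apply: covering_lifting; exact: mt_pi_covering. Qed.

Lemma upi_lifting : lifting R upi.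
Proof. exact: lifting_comp tpi_lifting mtpi_lifting. Qed.

Lemma vpi_lifting : lifting R vpi.
Proof. exact: lifting_comp upi_lifting ld. Qed.

Variables (x : M) (y0 : R * R) (r0 : R).
Local Notation e0 := (y0, r0).
Hypothesis x0 : vpi e0 = x.
Local Notation pend := (@pend R X M vpi x).

Lemma pend_inj a b e e' : pend a e e' -> pend b e e' -> a = b.
Proof.
move=> ae be; rewrite -(pi1_repr a) -(pi1_repr b); apply/pi1_classP.
exact: (ends_inj vpi_lifting (@convex3_continuous R) (@convex3_0 R) (@convex3_1 R)
  (@convex3_id R) ae be).
Qed.

Lemma upi_shift y r n : upi (shift y n, r) = upi (y, r).
Proof. by rewrite /upi /tpi /= torus_pi_shift. Qed.

Lemma line_continuous y v (r q : R) :
  continuous (fun t : R => (seg y v t, r + t * q) : X).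
Proof.
apply: continuous_pair; first exact: seg_continuous.
by move=> t; apply: cvgD; [exact: cvg_cst|exact: cvgM cvg_id (cvg_cst _)].
Qed.

Lemma line_class v q : upi (seg y0 v 1, r0 + q) = upi e0 ->
  exists a : pi1 R x, forall e e', pend a e e' <->
    ends vpi (fun t : I => vpi (seg y0 v (uival t), r0 + uival t * q)) e e'.
Proof.
have [cv _ _] := vpi_lifting => vq; apply: loop_class.
- exact: vpi_lifting.
- apply: (continuous_o (f := fun t : I => (seg y0 v (uival t), r0 + uival t * q) : X) _ cv).
  exact: (continuous_o (@uival_continuous R) 
    (line_continuous (y := y0) (v := v) (r := r0) (q := q))).
- by rewrite uival_zero seg0 mul0r addr0.
- by rewrite uival_one mul1r -x0 /vpi vq.
Qed.

Lemma translation_classes : exists iota : 'cV[int]_2 -> pi1 R x, forall n e e',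
  pend (iota n) e e' <-> ends vpi (fun t : I => vpi (seg y0 (ivec R n) (uival t), r0)) e e'.
Proof.
suff h n : exists a : pi1 R x, forall e e', pend a e e' <->
    ends vpi (fun t : I => vpi (seg y0 (ivec R n) (uival t), r0)) e e'.
  by have [iota iotaP] := choice h; exists iota.
have [|a aP] := @line_class (ivec R n) 0; first by rewrite addr0 seg1 upi_shift.
exists a => e e'; rewrite aP.
have -> // : (fun t : I => vpi (seg y0 (ivec R n) (uival t), r0 + uival t * 0)) =
  (fun t : I => vpi (seg y0 (ivec R n) (uival t), r0)).
by apply/funext => t; rewrite mulr0 addr0.
Qed.


(** A deck transformation carries [tpi z1] to [tpi z2], hence, by unique lifting, one lift of [a] to
    the other. *)
Lemma pend_deck (a : pi1 R x) z1 z1' z2 z2' : upi z1 = upi z2 ->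
  pend a z1 z1' -> pend a z2 z2' -> upi z1' = upi z2' /\ z2'.2 - z2.2 = z1'.2 - z1.2.
Proof.
move=> /(mt_pi_inj fK gK) [k zk] p1 p2.
have [ct _ _] := tpi_lifting.
have lD : lifting R (d \o mtpi) by apply: lifting_comp; [exact: mtpi_lifting|exact: ld].
have e1 : ends (d \o mtpi) (repr a) (tpi z1) (tpi z1') by exact: (ends_comp (Q := tpi)).
have e2 : ends (d \o mtpi) (repr a) (tpi z2) (tpi z2') by exact: (ends_comp (Q := tpi)).
have e3 : ends (d \o mtpi) (repr a) (mt_act f g k (tpi z1)) (mt_act f g k (tpi z1')).
  apply: (ends_map (P := d \o mtpi) (j := id)) e1; first exact: mt_act_continuous.
  by move=> z; rewrite /= mt_pi_act.
rewrite -zk in e3; have zE := ends_unique lD e3 e2.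
split; first by rewrite /upi -zE mt_pi_act.
have := congr1 snd zE; have := congr1 snd zk; rewrite /= => -> <-; lra.
Qed.

(** The degree of [a] over the circle, meaningful only when its lift to the mapping torus closes
    up. *)
Definition height (a : pi1 R x) (k : int) :=
  exists e', [/\ pend a e0 e', upi e' = upi e0 & e'.2 = r0 + k%:~R].

Lemma heightM a b k l : height a k -> height b l -> height (a * b)%g (k + l).
Proof.
move=> [e1 [a1 u1 h1]] [e2 [b2 u2 h2]].
have [_ Pe1] := pend_over a1.
have [e3 b3] := pend_exists vpi_lifting b Pe1.
have [u3 h3] := pend_deck (esym u1) b2 b3.
exists e3; split; first exact: (pendM vpi_lifting a1 b3).
  by rewrite -u3.
by move: h3; rewrite h1 h2 rmorphD /= => h3; lra.
Qed.

Lemma heightV a k : height a k -> height a^-1%g (- k).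
Proof.
move=> [e1 [a1 u1 h1]]; have aV := pendV vpi_lifting a1.
have [e2 a2] := pend_exists vpi_lifting (a^-1)%g x0.
have [u2 h2] := pend_deck u1 aV a2.
exists e2; split => //.
by move: h2; rewrite /= h1 rmorphN /= => h2; lra.
Qed.

Lemma height1 : height 1%g 0.
Proof. by exists e0; split; [exact: (pend1 vpi_lifting)| |rewrite addr0]. Qed.

Lemma heightX a k n : height a k -> height (a ^+ n)%g (k *+ n).
Proof.
move=> ak; elim: n => [|n IH]; first exact: height1.
by rewrite expgS mulrS; exact: heightM.
Qed.

Lemma height_expgz a k : height a 1 -> height (expgz a k) k.
Proof.
move=> a1; have aX n : height (a ^+ n)%g n by rewrite -[X in height _ X]natz; exact: heightX.
by case: k => n; [exact: aX|rewrite [X in height _ X]NegzE; exact/heightV/aX].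
Qed.

Lemma height_exists a e' : pend a e0 e' -> upi e' = upi e0 -> exists k, height a k.
Proof.
move=> ae ue; have /(mt_pi_inj fK gK) [k zk] := esym ue.
by exists k, e'; split => //; have := congr1 snd zk.
Qed.

(** At equal heights the deck transformation is trivial, so the endpoints agree in the torus. *)
Lemma height0_shift a : height a 0 -> exists n, pend a e0 (shift y0 n, r0).
Proof.
move=> [[y r] [ae ue]] /=; rewrite addr0 => rr; rewrite {}rr in ae ue.
have /(mt_pi_inj fK gK) [k [yk /esym]] := esym ue.
rewrite /= -[X in _ = X -> _]addr0 => /addrI.
rewrite -[0]/(0%:~R) => /intr_inj k0; rewrite k0 /= in yk.
by have /torus_piP [n yn] := esym yk; exists n; rewrite -yn.
Qed.

(** Relations are checked on endpoints of lifts from [e0]. Loops whose lift to the mapping torus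
    closes up lie in the semidirect product. *)
Theorem pi1_mapping_torus_cover : exists (iota : 'cV[int]_2 -> pi1 R x) (t : pi1 R x),
  [/\ forall m n, iota (m + n) = (iota m * iota n)%g, injective iota,
    forall n, (iota n * t = t * iota (A *m n))%g &
    forall a b, ~ semidirect iota t a -> ~ semidirect iota t b ->
      semidirect iota t (a * b^-1)%g].
Proof.
have lv := vpi_lifting; have [cv _ _] := lv.
have [iota iotaP] := translation_classes.
(* [t] is the image of the segment from [(y0, r0)] to [(y1, r0 + 1)]; raising the height by 1
   amounts to applying [f], so [y1] is taken over the preimage by [f]. *)
have [y1 y1E] := torus_pi_surj (g (torus_pi y0)).
pose v := (y1.1 - y0.1, y1.2 - y0.2).
have segv : seg y0 v 1 = y1.
  by rewrite /seg !mul1r /v /= addrC subrK addrC subrK; case: (y1).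
have fy1 : f (torus_pi y1) = torus_pi y0 by rewrite y1E gK.
have mt1 w r : mtpi (w, r + 1) = mtpi (f w, r).
  rewrite -(mt_pi_act fK gK 1 (f w, r)) /mt_act; congr (mtpi (_, _)).
  by rewrite /= fK.
have [|t tP] := @line_class v 1; first by rewrite segv /upi /tpi /= mt1 fy1.
have iota_end m n : pend (iota n) (shift y0 m, r0) (shift y0 (m + n), r0).
  apply/iotaP.
  have := ends_line (P := vpi) (g := fun t => (seg (shift y0 m) (ivec R n) t, r0)).
  rewrite seg0 seg1 shiftD; apply.
    by apply: continuous_pair; [exact: seg_continuous|move=> ?; exact: cvg_cst].
  move=> s; rewrite /vpi /upi /tpi /=; congr (d (mtpi (_, _))).
  by apply: torus_pi_seg; rewrite torus_pi_shift.
have t_end m : pend t (shift y0 m, r0) (shift y1 m, r0 + 1).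
  apply/tP.
  have := ends_line (P := vpi) (g := fun t => (seg (shift y0 m) v t, r0 + t * 1) : X).
  rewrite seg0 mul0r addr0 mul1r.
  have -> : seg (shift y0 m) v 1 = shift y1 m.
    rewrite -segv /seg /shift /= !mul1r; congr pair; exact: addrAC.
  apply; first exact: line_continuous.
  move=> s; rewrite /vpi /upi /tpi /=; congr (d (mtpi (_, _))).
  by apply: torus_pi_seg; rewrite torus_pi_shift.
(* Brought down to height [r0], a linear loop at height [r0 + 1] becomes its image under [f], which
   [fA] deforms to the linear loop of [A *m n]. *)
have iota_end1 n : pend (iota (A *m n)) (y1, r0 + 1) (shift y1 n, r0 + 1).
  apply/iotaP.
  have /pi1_classP [H [cH H0 H1 Hxy]] : pi1_class (f \o torus_line (torus_pi y1) n :
      {path I from f (torus_pi y1) to f (torus_pi y1) in T}) =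
      pi1_class (torus_line (f (torus_pi y1)) (A *m n)).
    by rewrite -fA pi1_map_class.
  pose j w := d (mtpi (w, r0)).
  have cj : continuous j.
    have [cd _ _] := ld; apply: (continuous_o _ cd).
    have [cm _ _] := mtpi_lifting.
    apply: (continuous_o (f := fun w : T => (w, r0)) _ cm).
    by apply: continuous_pair => w; [exact: cvg_id|exact: cvg_cst].
  rewrite (_ : (fun s => vpi _) = fun s => (j \o H) (one, s)); last first.
    by apply/funext => s; rewrite /= H1 fy1 torus_line_seg.
  apply: (ends_square lv); first exact: (continuous_o cH cj).
  - by move=> s /=; rewrite (Hxy s).1 (Hxy zero).1.
  - by move=> s /=; rewrite (Hxy s).2 (Hxy zero).2.
  have := ends_line (P := vpi) (g := fun t => (seg y1 (ivec R n) t, r0 + 1)).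
  rewrite seg0 seg1; apply.
    by apply: continuous_pair; [exact: seg_continuous|move=> ?; exact: cvg_cst].
  by move=> s; rewrite /= H0 /= torus_line_seg /j -mt1.
have iota_e0 n : pend (iota n) e0 (shift y0 n, r0).
  by have := iota_end 0 n; rewrite add0r shift0.
have t_e0 : pend t e0 (y1, r0 + 1) by have := t_end 0; rewrite !shift0.
have ht : height t 1.
  by exists (y1, r0 + 1); split => //; rewrite /upi /tpi /= mt1 fy1.
(* Dividing by the power of [t] of the same height leaves height 0, that is, a translation. *)
have sd a e' : pend a e0 e' -> upi e' = upi e0 -> semidirect iota t a.
  move=> ae ue; have [k ak] := height_exists ae ue.
  have : height (a * (expgz t k)^-1)%g 0.
    by rewrite -(subrr k); apply: heightM => //; apply/heightV/height_expgz.
  move=> /height0_shift [n an]; exists n, k.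
  by rewrite -(pend_inj an (iota_e0 n)) mulgVK.
exists iota, t; split.
- move=> m n; apply: (pend_inj (iota_e0 _)).
  exact: (pendM lv (iota_e0 m) (iota_end m n)).
- move=> m n mn; have := iota_e0 m; rewrite mn => mE.
  by have [] := pend_unique lv mE (iota_e0 n) => /addrI /intr_inj e1 /addrI /intr_inj e2;
    apply: (@shift_inj R y0); rewrite /shift e1 e2.
- move=> n; apply: (pend_inj (e' := (shift y1 n, r0 + 1))).
    exact: (pendM lv (iota_e0 n) (t_end n)).
  exact: (pendM lv t_e0 (iota_end1 n)).
- move=> a b aN bN.
  have [ea ae] := pend_exists lv a x0.
  have [eb be] := pend_exists lv b x0.
  have [_ Pa] := pend_over ae; have [_ Pb] := pend_over be.
  (* The fibre of [d] has at most two points, and neither lift ends over [upi e0], so both end over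
     the other point. *)
  have uab : upi eb = upi ea.
    have dab : d (upi ea) = d (upi eb) by rewrite -[LHS]/(vpi ea) Pa -Pb.
    have da0 : d (upi ea) = d (upi e0) by rewrite -[LHS]/(vpi ea) Pa -x0.
    by case: (fib dab da0) => [->|/(sd _ _ ae)/aN|/(sd _ _ be)/bN].
  have bV := pendV lv be.
  have [e3 b3] := pend_exists lv b^-1%g Pa.
  have [u3 _] := pend_deck uab bV b3.
  exact: sd (pendM lv ae b3) (esym u3).
Qed.

End Monodromy.

(** * Property A for Anosov bundles and doubles *)

Lemma property_A_mapping_torus_cover (R : realType)
    (f : continuousType (torus R) (torus R)) (A : 'M[int]_2)
    (M : topologicalType) (d : mapping_torus f -> M) (x : M) :
  homeomorphism f -> \det A = 1 -> 2 < `|\tr A| -> acts_on_pi1_by f A ->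
  lifting R d -> (forall b, exists e, d e = b) ->
  (forall e1 e2 e3, d e1 = d e2 -> d e1 = d e3 ->
    [\/ e1 = e2, e1 = e3 | e2 = e3]) ->
  property_A (pi1 R x).
Proof.
move=> [_ [g [cg fK gK]]] detA trA fA ld surjd fib.
have [e de] := surjd x; have [[w r0] ew] := mt_pi_surj gK e.
have [y0 yw] := torus_pi_surj w.
have x0 : vpi g d (y0, r0) = x by rewrite /vpi /upi /tpi /= yw ew.
have [iota [t [iotaD iota_inj iotat idx]]] :=
  pi1_mapping_torus_cover cg fK gK fA ld fib x0.
exact: sol_property_A detA trA iotaD iota_inj iotat idx.
Qed.

Theorem proposition2p10 (R : realType) (M : topologicalType) (x : M) :
  Anosov_bundle R M \/ Anosov_double R M -> property_A (pi1 R x).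
Proof.
(* Homeomorphisms are reversed so that they start from the mapping torus, where loops are lifted. *)
have homeo_sym (E N : topologicalType) : homeomorphic E N ->
    exists h : N -> E, [/\ homeomorphism h, injective h & forall b, exists e, h e = b].
  move=> [h [ch [k [ck hK kK]]]]; exists k; split; last by move=> b; exists (h b).
    by split => //; exists h.
  exact: can_inj kK.
case=> [[f [A [hf detA trA fA /homeo_sym [h [hh injh surjh]]]]]|].
  apply: (property_A_mapping_torus_cover (d := h) hf detA trA fA);
    first exact: homeomorphism_lifting.
    exact: surjh.
  by move=> e1 e2 e3 /injh e12 _; apply: Or31.
move=> [_ [E [p [[f [A [hf detA trA fA /homeo_sym [h [hh injh surjh]]]]] dp _]]]].
apply: (property_A_mapping_torus_cover hf detA trA fA (d := p \o h)).
- apply: lifting_comp; first exact: homeomorphism_lifting.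
  by apply: covering_lifting; exact: double_covering_map.
- move=> b; have [e' <-] := double_covering_surj dp b.
  by have [e <-] := surjh e'; exists e.
- move=> e1 e2 e3 p12 p13.
  by case: (double_covering_card dp p12 p13) => /injh; [apply: Or31|apply: Or32|apply: Or33].
Qed.
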